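(* Let $a,b\in\mathbb D$, let $\{\alpha(n)\}_{n\in\mathbb Z}$ be a sequence in $\mathbb D$ such that $\alpha(0)\alpha(1)\alpha(2)\cdots$ is the Fibonacci sequence over $\{a,b\}$, and let $\mathcal E$ be the associated extended CMV matrix on $\ell^2(\mathbb Z)$. Let $\Sigma\subset\partial\mathbb D$ be the set of $z\in\partial\mathbb D$ for which the traces of the transfer matrices over Fibonacci lengths, $\operatorname{tr}\,T_{q_k}(z)$, $k\ge0$, form a bounded sequence. Then there exist constants $\gamma_1,\gamma_2>0$ and $C_1,C_2,L_0>0$ such that for every $z\in\Sigma$ every normalized solution $\eta(z)$ of the transfer matrix recursion at $z$ satisfies $C_1L^{\gamma_1}\le\|\eta(z)\|_L\le C_2L^{\gamma_2}$ for all $L\ge L_0$, and, with $\beta=\frac{2\gamma_1}{\gamma_1+\gamma_2}$, the spectral measure $\Lambda=\mu_{\delta_0}+\mu_{\delta_1}$ of $\mathcal E$ is uniformly $\beta$-Hölder continuous on $\Sigma$.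
   Context: $\mathbb D$ is the open unit disk in $\mathbb C$ and $\rho(n)=\sqrt{1-|\alpha(n)|^2}$. The Fibonacci sequence over $\{a,b\}$ is the one-sided infinite word $abaababa\cdots$ which is the limit of the words $s_0=a$, $s_1=ab$, $s_{k+1}=s_ks_{k-1}$ (fixed point of the substitution $a\mapsto ab$, $b\mapsto a$). The integers $q_0=1,q_1=2,q_{k+1}=q_k+q_{k-1}$ are the lengths of $s_k$. Extended CMV matrix: $\mathcal E$ is the unitary operator on $\ell^2(\mathbb Z)$ whose entries $\mathcal E_{j,k}$ (row $j$, column $k$) are, for every $m\in\mathbb Z$: in row $2m$, $\mathcal E_{2m,2m-1}=\overline{\alpha(2m)}\rho(2m-1)$, $\mathcal E_{2m,2m}=-\overline{\alpha(2m)}\alpha(2m-1)$, $\mathcal E_{2m,2m+1}=\overline{\alpha(2m+1)}\rho(2m)$, $\mathcal E_{2m,2m+2}=\rho(2m+1)\rho(2m)$; in row $2m+1$, $\mathcal E_{2m+1,2m-1}=\rho(2m)\rho(2m-1)$, $\mathcal E_{2m+1,2m}=-\rho(2m)\alpha(2m-1)$, $\mathcal E_{2m+1,2m+1}=-\overline{\alpha(2m+1)}\alpha(2m)$, $\mathcal E_{2m+1,2m+2}=-\rho(2m+1)\alpha(2m)$; all other entries are $0$. $\{\delta_k\}$ is the standard basis of $\ell^2(\mathbb Z)$. Transfer matrices: $A_n(z)=\frac1{\rho(n)}\begin{pmatrix}z&-\overline{\alpha(n)}\\-\alpha(n)z&1\end{pmatrix}$ and $T_n(z)=A_{n-1}(z)\cdots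 A_1(z)A_0(z)$. Transfer matrix recursion at $z\in\partial\mathbb D$: a sequence $\eta=(\eta_j)_{j\ge0}$ of complex numbers is a solution if $(\eta_{2n+3},\eta_{2n+2})^T=A_n(z)(\eta_{2n+1},\eta_{2n})^T$ for all $n\ge0$. It is normalized if $|\eta_0|^2+|\eta_1|^2=2$. For an integer $n\ge0$, $\|\eta\|_n=\big(\sum_{j=0}^n|\eta_j|^2\big)^{1/2}$; for non-integer $L>0$, $\|\eta\|_L$ is defined by linear interpolation between consecutive integers. The spectral measure $\mu_\varphi$ of $\mathcal E$ for $\varphi\in\ell^2(\mathbb Z)$ is the Borel measure on $\partial\mathbb D$ with $\langle\varphi,(\mathcal E-w)^{-1}\varphi\rangle=\int\frac{d\mu_\varphi(\zeta)}{\zeta-w}$ for $w\in\mathbb C\setminus\partial\mathbb D$. A measure $\mu$ on $\partial\mathbb D$ is uniformly $\beta$-Hölder continuous on $\Sigma$ if there are $C,\epsilon_0>0$ such that $\mu(\{e^{i\theta}:|\theta-\Theta|\le\epsilon\})\le C\epsilon^\beta$ for all $e^{i\Theta}\in\Sigma$ and $0<\epsilon<\epsilon_0$. *)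

(* Defs.v *)
From HB Require Import structures.
From mathcomp Require Import all_boot all_order all_algebra.
From mathcomp Require Import all_classical all_reals all_analysis.
From mathcomp Require Import complex.

Set Implicit Arguments.
Unset Strict Implicit.
Unset Printing Implicit Defensive.

Import Order.TTheory GRing.Theory Num.Theory.
Import numFieldNormedType.Exports.
Import ComplexField.Normc.

Local Open Scope classical_set_scope.
Local Open Scope ring_scope.
Local Open Scope complex_scope.

(* [normc z] is the modulus as an element of R, whereas [`|z|] lives in R[i]. *)

Definition unit_disk (R : realType) : set R[i] := [set z | normc z < 1].

Definition unit_circle (R : realType) : set R[i] := [set z | normc z = 1].

Fixpoint fib_word (T : Type) (a b : T) (k : nat) : seq T :=
  match k with
  | 0 => [:: a]
  | 1 => [:: a; b]
  | (k'.+1 as k1).+1 => fib_word a b k1 ++ fib_word a b k'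
  end.

Fixpoint fib_length (k : nat) : nat :=
  match k with
  | 0 => 1
  | 1 => 2
  | (k'.+1 as k1).+1 => fib_length k1 + fib_length k'
  end%N.

(* u is the limit of the words s_k: each s_k is a prefix of s_(k+1), so the
   limit is the infinite word having every s_k as a prefix. *)
Definition is_fibonacci_sequence (T : Type) (a b : T) (u : nat -> T) : Prop :=
  forall k, mkseq u (size (fib_word a b k)) = fib_word a b k.

Definition rho (R : realType) (alpha : int -> R[i]) (n : int) : R :=
  Num.sqrt (1 - normc (alpha n) ^+ 2).

Definition cmv (R : realType) (alpha : int -> R[i]) (j k : int) : R[i] :=
  let r n := (rho alpha n)%:C in
  let m := (j %/ 2)%Z in
  if j == 2 * m then
    if k == 2 * m - 1 then (alpha (2 * m))^* * r (2 * m - 1)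
    else if k == 2 * m then - (alpha (2 * m))^* * alpha (2 * m - 1)
    else if k == 2 * m + 1 then (alpha (2 * m + 1))^* * r (2 * m)
    else if k == 2 * m + 2 then r (2 * m + 1) * r (2 * m)
    else 0
  else (* j = 2 * m + 1 *)
    if k == 2 * m - 1 then r (2 * m) * r (2 * m - 1)
    else if k == 2 * m then - r (2 * m) * alpha (2 * m - 1)
    else if k == 2 * m + 1 then - (alpha (2 * m + 1))^* * alpha (2 * m)
    else if k == 2 * m + 2 then - r (2 * m + 1) * alpha (2 * m)
    else 0.

Definition l2Z (R : realType) : set (int -> R[i]) :=
  [set f | (\esum_(k in [set: int]) (normc (f k) ^+ 2)%:E < +oo)%E].

Definition delta (R : realType) (k : int) : int -> R[i] :=
  fun j => (j == k)%:R.

(* Linear in the second argument.  On l2Z the series converges absolutely, so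
   the symmetric partial sums over -N, ..., N compute it. *)
Definition l2_inner (R : realType) (f g : int -> R[i]) : R[i] :=
  limn (fun N : nat =>
    \sum_(i < (2 * N).+1%N) (f (i%:Z - N%:Z))^* * g (i%:Z - N%:Z) : R[i]^o).

(* Each row of cmv alpha has finitely many nonzero entries, so the
   finite-support sum is the full matrix-vector product. *)
Definition cmv_op (R : realType) (alpha : int -> R[i]) (f : int -> R[i]) :
    int -> R[i] :=
  fun j => \sum_(k \in [set: int]) cmv alpha j k * f k.

(* (A - w)^-1 phi, the vector psi of l^2(Z) with (A - w) psi = phi; the default
   value 0 is only used when there is no such vector. *)
Definition resolvent (R : realType) (A : (int -> R[i]) -> int -> R[i])
    (w : R[i]) (phi : int -> R[i]) : int -> R[i] :=
  xget (fun _ => 0)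
    [set psi | l2Z psi /\ forall j, A psi j - w * psi j = phi j].

(* The complex plane with its Borel sigma-algebra; a Borel measure on the unit
   circle is represented as a Borel measure on the plane concentrated there. *)
Notation borelC R := (g_sigma_algebraType (@open (R[i])^o)).

Definition integralC d (T : measurableType d) (R : realType)
    (mu : {measure set T -> \bar R}) (D : set T) (f : T -> R[i]) : R[i] :=
  Rintegral mu D (fun x => complex.Re (f x))
  +i* Rintegral mu D (fun x => complex.Im (f x)).

Definition is_spectral_measure (R : realType)
    (A : (int -> R[i]) -> int -> R[i]) (phi : int -> R[i])
    (mu : {finite_measure set (borelC R) -> \bar R}) : Prop :=
  mu (~` @unit_circle R) = 0%E /\
  forall w : R[i], ~ unit_circle w ->
    l2_inner phi (resolvent A w phi)
    = integralC mu (@unit_circle R) (fun zeta => ((zeta : R[i]) - w)^-1).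

Definition expi (R : realType) (theta : R) : R[i] := cos theta +i* sin theta.

Definition arc (R : realType) (Theta eps : R) : set (borelC R) :=
  [set expi theta | theta in [set theta | `|theta - Theta| <= eps]].

Definition uniformly_holder (R : realType) (beta : R) (S : set R[i])
    (mu : {measure set (borelC R) -> \bar R}) : Prop :=
  exists C eps0 : R, [/\ 0 < C, 0 < eps0 &
    forall Theta eps : R, S (expi Theta) -> 0 < eps < eps0 ->
      (mu (arc Theta eps) <= (C * eps `^ beta)%:E)%E].

Definition szego_matrix (R : realType) (alpha : int -> R[i]) (n : nat)
    (z : R[i]) : 'M[R[i]]_2 :=
  ((rho alpha n%:Z)%:C)^-1 *:
    \matrix_(i < 2, j < 2)
      nth 0 (nth [::] [:: [:: z; - (alpha n%:Z)^* ];
                          [:: - alpha n%:Z * z; 1 ] ] i) j.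

Fixpoint transfer_matrix (R : realType) (alpha : int -> R[i]) (n : nat)
    (z : R[i]) : 'M[R[i]]_2 :=
  if n is n'.+1 then szego_matrix alpha n' z *m transfer_matrix alpha n' z
  else 1%:M.

Definition transfer_solution (R : realType) (alpha : int -> R[i]) (z : R[i])
    (eta : nat -> R[i]) : Prop :=
  forall n : nat,
    \col_(i < 2) [:: eta (2 * n + 3)%N; eta (2 * n + 2)%N]`_i
    = szego_matrix alpha n z
      *m \col_(i < 2) [:: eta (2 * n + 1)%N; eta (2 * n)%N]`_i.

Definition normalized (R : realType) (eta : nat -> R[i]) : Prop :=
  normc (eta 0%N) ^+ 2 + normc (eta 1%N) ^+ 2 = 2.

Definition norm_upto (R : realType) (eta : nat -> R[i]) (n : nat) : R :=
  Num.sqrt (\sum_(j < n.+1) normc (eta j) ^+ 2).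

Definition norm_at (R : realType) (eta : nat -> R[i]) (L : R) : R :=
  let n := Num.truncn L in
  norm_upto eta n + (L - n%:R) * (norm_upto eta n.+1 - norm_upto eta n).

Definition bounded_trace_set (R : realType) (alpha : int -> R[i]) : set R[i] :=
  [set z | unit_circle z /\
    exists M : R, forall k : nat,
      normc (\tr (transfer_matrix alpha (fib_length k) z)) <= M].

(* Main.v *)
Require Import Defs.
From HB Require Import structures.
From mathcomp Require Import all_boot all_order all_algebra.
From mathcomp Require Import all_classical all_reals all_analysis.
From mathcomp Require Import complex.
From mathcomp Require Import zify ring lra.

Set Implicit Arguments.
Unset Strict Implicit.
Unset Printing Implicit Defensive.

Import Order.TTheory GRing.Theory Num.Theory.
Import numFieldNormedType.Exports.
Import ComplexField.Normc.

Local Open Scope classical_set_scope.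
Local Open Scope ring_scope.
Local Open Scope complex_scope.

(** Write the energy as z = s^2 with |s| = 1.  Dividing each one-step
transfer matrix by s puts it in SL(2), so the whole problem concerns products of two
SL(2) matrices along the Fibonacci word.  Let M_k be the product over the word
s_(k-1).  Then M_(k+2) = M_k M_(k+1), and the traces x_k satisfy
x_(k+3) = x_(k+2) x_(k+1) - x_k.

A bounded orbit of this trace map obeys a bound B that depends only on a and
b: two consecutive traces of modulus larger than 2 must be preceded by a larger
one (otherwise the orbit escapes), and an isolated large trace is controlled by
the Fricke-Vogt invariant ([trace_orbit_bound]).

Upper power law.  By Cayley-Hamilton the product along any prefix of the word is
a combination of 1, M_k, M_(k+1), M_(k+2).  One substitution step changes the
coefficients by a bounded factor, so the products grow at most geometrically in
k, that is polynomially in the length ([fib_orbit_upper]).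

Lower power law.  The first q_k + q_(k+1) - 2 letters of the word have period q_k.
Hence each vector of a solution with a small enough index is followed
by two periods of length q_k, and Cayley-Hamilton expresses it through the
vectors one and two periods later.  The sum of squares is therefore multiplied by
a fixed factor every four levels ([fib_orbit_growth]).  Only the bound on
the traces enters, and only up to the level considered.

Hoelder continuity.  Let psi solve (E - w) psi = delta_c with c = 0 or 1 and
w = (1 - e)^2 z.  As E is isometric, (1 - |w|^2) ||psi||^2 is at most
1 + 2 |psi_c|.  On the right half-line psi is a solution at energy w.  The trace
map multiplies a perturbation by a bounded factor at each level, so at w
the traces stay below B + 1 for as many levels as log (1/e) allows
([trace_orbit_perturb]); the lower power law over these levels shows that the
values of psi near the origin are much smaller than ||psi||.  Together the two
facts bound |psi_c| by a constant plus A / (e l^n), with l > 1 and n of order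
log (1/e) ([resolvent_entry_bound]).  Since psi_c is the Borel transform of the
spectral measure at w, the Poisson kernel turns this into a bound for the
measure of an arc of radius e by a power of e ([spectral_arc_holder]).  The upper
exponent of the power law may be enlarged freely, which brings
2 gamma1 / (gamma1 + gamma2) below the exponent so obtained. *)


(** * Two by two matrices and the Fibonacci recursion *)

Section TwoByTwo.
Context {F : fieldType}.
Implicit Types A B : 'M[F]_2.

Lemma mulmx2E m n (A : 'M[F]_(m, 2)) (B : 'M[F]_(2, n)) i j :
  (A *m B) i j = A i 0 * B 0 j + A i 1 * B 1 j.
Proof. by rewrite mxE !big_ord_recl big_ord0 addr0 !ord1; congr (_ + A i _ * B _ j);
  apply: val_inj. Qed.

Lemma mxtrace2E A : \tr A = A 0 0 + A 1 1.
Proof. by rewrite /mxtrace !big_ord_recl big_ord0 addr0; congr (_ + A _ _);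
  apply: val_inj. Qed.

Lemma mx2P A B : A 0 0 = B 0 0 -> A 0 1 = B 0 1 -> A 1 0 = B 1 0 ->
  A 1 1 = B 1 1 -> A = B.
Proof.
move=> e00 e01 e10 e11; apply/matrixP=> i j.
by case: (unliftP 0 i) => [i'|] ->; case: (unliftP 0 j) => [j'|] ->;
  rewrite ?ord1 // (_ : lift 0 0 = 1) //; apply: val_inj.
Qed.

Lemma cV2P (X Y : 'cV[F]_2) : X 0 0 = Y 0 0 -> X 1 0 = Y 1 0 -> X = Y.
Proof.
move=> e0 e1; apply/matrixP=> i j; rewrite ord1.
by case: (unliftP 0 i) => [i'|] ->; rewrite ?ord1 // (_ : lift 0 0 = 1) //;
  apply: val_inj.
Qed.

Lemma lift02 : lift 0 0 = 1 :> 'I_2. Proof. exact: val_inj. Qed.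
Lemma lift12 : lift 1 0 = 0 :> 'I_2. Proof. exact: val_inj. Qed.

Lemma det2E A : \det A = A 0 0 * A 1 1 - A 0 1 * A 1 0.
Proof.
rewrite (expand_det_row _ 0) !big_ord_recl big_ord0 addr0 /cofactor !det_mx11.
by rewrite !mxE !lift02 !lift12 expr0 expr1; ring.
Qed.

Lemma cayley_hamilton2 A : A *m A = \tr A *: A - (\det A)%:M.
Proof.
by apply: mx2P; rewrite mulmx2E mxtrace2E det2E !mxE /=; ring.
Qed.

(** The polarization of Cayley-Hamilton.  It lets a product in the wrong order be
exchanged for the right one up to linear terms. *)
Lemma cayley_hamilton2_polar A B : A *m B + B *m A =
  \tr A *: B + \tr B *: A + (\tr (A *m B) - \tr A * \tr B)%:M.
Proof.
apply: mx2P; rewrite [LHS]mxE [RHS]mxE [X in _ = X + _]mxE !mulmx2E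
  !mxtrace2E !mulmx2E !mxE /=; ring.
Qed.
End TwoByTwo.

(** The matrices of the words b, a, ab, aba, ...: the product over s_(k-1), with
B and A the matrices of the letters b and a.  Matrices act from the left, so the
order of the factors is opposite to that of the words. *)
Fixpoint fib_mx (F : fieldType) (B A : 'M[F]_2) (k : nat) : 'M[F]_2 :=
  match k with
  | 0 => B
  | 1 => A
  | (k'.+1 as k1).+1 => fib_mx B A k' *m fib_mx B A k1
  end.

Section FibonacciMatrices.
Context {F : fieldType}.
Variables A B : 'M[F]_2.
Hypotheses (detA : \det A = 1) (detB : \det B = 1).
Local Notation M := (fib_mx B A).
Local Notation x k := (\tr (M k)).

Lemma fib_mxSS k : M k.+2 = M k *m M k.+1. Proof. by []. Qed.

Lemma det_fib_mx k : \det (M k) = 1.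
Proof.
suff: \det (M k) = 1 /\ \det (M k.+1) = 1 by case.
by elim: k => [//|k [IH0 IH1]]; rewrite fib_mxSS det_mulmx IH0 IH1 mulr1.
Qed.

Lemma fib_mx_sqr k : M k *m M k = x k *: M k - 1%:M.
Proof. by rewrite cayley_hamilton2 det_fib_mx. Qed.

Lemma fib_mx_mulr k : M k.+2 *m M k.+1 = x k.+1 *: M k.+2 - M k.
Proof.
by rewrite fib_mxSS -mulmxA fib_mx_sqr mulmxBr -scalemxAr mulmx1.
Qed.

Lemma fib_mx_trace_rec k : x k.+3 = x k.+2 * x k.+1 - x k.
Proof.
rewrite [M k.+3]fib_mxSS mxtrace_mulC fib_mx_mulr raddfB /= mxtraceZ.
by rewrite mulrC.
Qed.

(** Cayley-Hamilton for M_(k+1) M_(k+2), whose reversed product is known.  With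
bounded traces this linear recursion gives at most geometric growth, and it
also expresses M_k through the three later matrices. *)
Lemma fib_mx_linear_rec k : M k.+3 = x k.+2 *: M k.+1 + M k - (x k)%:M.
Proof.
have := cayley_hamilton2_polar (M k.+1) (M k.+2).
rewrite fib_mx_mulr -fib_mxSS fib_mx_trace_rec => /(canRL (addrK _)) ->.
by apply: mx2P; rewrite !mxE /=; ring.
Qed.
End FibonacciMatrices.

(** * Fibonacci words and cocycles over them *)

Section FibonacciLength.
Local Notation q := fib_length.

Lemma fib_lengthSS k : q k.+2 = (q k.+1 + q k)%N. Proof. by []. Qed.

Lemma fib_length_gt0 k : (0 < q k)%N.
Proof.
suff: (0 < q k)%N /\ (0 < q k.+1)%N by case.
by elim: k => [//|k [IH0 IH1]]; rewrite fib_lengthSS addn_gt0 IH1.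
Qed.

Lemma leq_fib_length m n : (m <= n)%N -> (q m <= q n)%N.
Proof.
apply: (homo_leq leqnn leq_trans) => {m n} -[|k] //.
by rewrite fib_lengthSS leq_addr.
Qed.

Lemma fib_length_upper k : (q k <= 2 ^ k)%N.
Proof.
suff: (q k <= 2 ^ k /\ q k.+1 <= 2 ^ k.+1)%N by case.
elim: k => [//|k [IH0 IH1]]; split=> //.
have := leq_fib_length (leqnSn k).
rewrite fib_lengthSS [(2 ^ _.+2)%N]expnS; lia.
Qed.

Lemma fib_length_lower k : (2 ^ k <= q (2 * k))%N.
Proof.
elim: k => [//|k IH].
rewrite mulnS [q _]fib_lengthSS expnS.
have := leq_fib_length (leqnSn (2 * k)); lia.
Qed.
End FibonacciLength.

Section FibonacciWord.
Variables (T : Type) (a b : T) (u : nat -> T).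
Hypothesis hu : is_fibonacci_sequence a b u.
Local Notation q := fib_length.

Lemma size_fib_word k : size (fib_word a b k) = q k.
Proof.
suff: size (fib_word a b k) = q k /\ size (fib_word a b k.+1) = q k.+1 by case.
elim: k => [//|k [IH0 IH1]]; split=> //.
by rewrite fib_lengthSS -IH0 -IH1 -size_cat.
Qed.

Lemma fib_sequence0 : u 0 = a. Proof. by case: (hu 0). Qed.
Lemma fib_sequence1 : u 1 = b. Proof. by case: (hu 1). Qed.

Lemma fib_word_nth k n : (n < q k)%N -> nth a (fib_word a b k) n = u n.
Proof. by move=> ltn; rewrite -hu nth_mkseq // size_fib_word. Qed.

Lemma fib_sequence_shift k n : (n < q k)%N -> u (q k.+1 + n) = u n.
Proof.
move=> ltn; rewrite -(@fib_word_nth k.+2) ?fib_lengthSS ?ltn_add2l //.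
rewrite [fib_word _ _ _]/(fib_word a b k.+1 ++ fib_word a b k).
by rewrite nth_cat size_fib_word ltnNge leq_addr /= addKn fib_word_nth.
Qed.

(** The word starts with s_(k+1) s_k and also with s_k s_(k+1) up to the last two
letters, whence the two letters lost at the end.  By induction: after a common
shift by q_(k-1) the claim for k becomes the claim for k - 1. *)
Lemma fib_sequence_period k n : (n.+2 < q k.+1)%N -> u (q k + n) = u n.
Proof.
elim: k n => [|k IH] n; first by rewrite /=; lia.
rewrite fib_lengthSS => ltn.
have [/fib_sequence_shift//|leqn] := ltnP n (q k).
have ->: n = (q k + (n - q k))%N by lia.
rewrite addnA -fib_lengthSS fib_sequence_shift ?IH //; lia.
Qed.

End FibonacciWord.

Section Cocycle.
Context {F : fieldType}.
Implicit Types N : nat -> 'M[F]_2.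

(** The transfer matrix from position j to position j + n. *)
Fixpoint cocycle N (j n : nat) : 'M[F]_2 :=
  if n is n'.+1 then N (j + n')%N *m cocycle N j n' else 1%:M.

Lemma cocycleD N j m n :
  cocycle N j (m + n) = cocycle N (j + m) n *m cocycle N j m.
Proof.
elim: n => [|n IH]; first by rewrite addn0 mul1mx.
by rewrite addnS /= IH mulmxA addnA.
Qed.

Lemma eq_cocycle N j k n : (forall i, (i < n)%N -> N (j + i)%N = N (k + i)%N) ->
  cocycle N j n = cocycle N k n.
Proof.
elim: n => [//|n IH] eN /=; rewrite eN // IH // => i lti.
by apply: eN; apply: ltnW.
Qed.

Lemma det_cocycle N j n : (forall i, \det (N i) = 1) -> \det (cocycle N j n) = 1.
Proof. by move=> dN; elim: n => [|n IH] /=; rewrite ?det1 // det_mulmx dN IH mulr1. Qed.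

Lemma cocycle_orbit N (X : nat -> 'cV[F]_2) j n :
    (forall i, (j <= i < j + n)%N -> X i.+1 = N i *m X i) ->
  X (j + n)%N = cocycle N j n *m X j.
Proof.
elim: n => [|n IH] XN; first by rewrite addn0 mul1mx.
rewrite addnS XN ?IH /= ?mulmxA // => [i /andP[ji ijn]|]; last by lia.
by rewrite XN // ji /=; lia.
Qed.

(** Over a periodic stretch, moving the window by one conjugates the product. *)
Lemma cocycle_trace_rotate N j n : \det (N j) = 1 -> N (j + n)%N = N j ->
  \tr (cocycle N j.+1 n) = \tr (cocycle N j n).
Proof.
move=> dN eN.
have e : cocycle N j.+1 n *m N j = N j *m cocycle N j n.
  have := cocycleD N j 1 n; rewrite add1n addn1 [cocycle N j 1]/= addn0 mulmx1 => <-.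
  by rewrite /= eN.
have uN : N j \in unitmx by rewrite unitmxE dN unitr1.
by rewrite -[cocycle N j.+1 n](mulmxK uN) e mxtrace_mulC mulmxA mulVmx // mul1mx.
Qed.
End Cocycle.

Section FibonacciCocycle.
Context {F : fieldType}.
Variables (T : Type) (a b : T) (u : nat -> T) (g : T -> 'M[F]_2).
Hypothesis hu : is_fibonacci_sequence a b u.
Hypothesis detg : forall n, \det (g (u n)) = 1.
Local Notation q := fib_length.
Local Notation N := (fun n => g (u n)).
Local Notation M := (fib_mx (g b) (g a)).

Lemma fib_cocycleD k n : (n <= q k)%N ->
  cocycle N 0 (q k.+1 + n) = cocycle N 0 n *m cocycle N 0 (q k.+1).
Proof.
move=> nq; rewrite cocycleD add0n; congr (_ *m _); apply: eq_cocycle => i lti.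
by rewrite (fib_sequence_shift hu) ?add0n //; apply: leq_trans lti nq.
Qed.

Lemma fib_cocycleE k : cocycle N 0 (q k) = M k.+1.
Proof.
suff: cocycle N 0 (q k) = M k.+1 /\ cocycle N 0 (q k.+1) = M k.+2 by case.
elim: k => [|k [IH0 IH1]]; last first.
  by split=> //; rewrite fib_lengthSS fib_cocycleD // IH0 IH1.
by rewrite /= !add0n mulmx1 (fib_sequence0 hu) (fib_sequence1 hu).
Qed.

(** The first q_(k+3) - 2 letters have period q_(k+1): windows of that length inside
them repeat, and moving such a window only rotates its word. *)
Lemma fib_square k j : (j.+2 <= q k)%N ->
  cocycle N (j + q k.+1) (q k.+1) = cocycle N j (q k.+1) /\
  \tr (cocycle N j (q k.+1)) = \tr (M k.+2).
Proof.
move=> jq.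
have per i : (i < j + q k.+1)%N -> u (q k.+1 + i) = u i.
  by move=> ltj; apply: (fib_sequence_period hu); rewrite fib_lengthSS; lia.
split; first by apply: eq_cocycle => i lti; rewrite addnAC addnC per // ltn_add2l.
rewrite -fib_cocycleE.
have: (j <= j + q k.+1)%N by rewrite leq_addr.
elim: {1 3}j => [//|i IH] ltij.
by rewrite cocycle_trace_rotate ?IH // 1?ltnW // addnC per.
Qed.
End FibonacciCocycle.

(** * Moduli of complex numbers and bounded orbits of the trace map *)

Section Modulus.
Context {R : rcfType}.
Implicit Types x y : R[i].

Lemma normc_ge0 x : 0 <= normc x.
Proof. by case: x => p r; rewrite /normc sqrtr_ge0. Qed.

Lemma sqr_normcE x : normc x ^+ 2 = complex.Re x ^+ 2 + complex.Im x ^+ 2.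
Proof. by case: x => p r; rewrite /normc sqr_sqrtr //= addr_ge0 ?sqr_ge0. Qed.

Lemma normcX x n : normc (x ^+ n) = normc x ^+ n.
Proof. by elim: n => [|n IH]; rewrite ?expr0 ?normc1 // !exprS normcM IH. Qed.

Lemma ler_normcB x y : normc (x - y) <= normc x + normc y.
Proof. by rewrite -(normcN y); exact: le_normcD. Qed.

Lemma lerB_normcD x y : normc x - normc y <= normc (x + y).
Proof. by have := ler_normcB (x + y) y; rewrite addrK; lra. Qed.

Lemma normc_conj x : normc (x^*)%R = normc x.
Proof. by case: x => p r; rewrite /normc /= sqrrN. Qed.

Lemma normcR (r : R) : normc r%:C = `|r|.
Proof. by rewrite /normc /= expr0n addr0 sqrtr_sqr. Qed.

Lemma mulc_conj x : x * (x^*)%R = (normc x ^+ 2)%:C.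
Proof. by rewrite sqr_normcE; case: x => p r; apply/eqP; rewrite eq_complex /=;
  apply/andP; split; apply/eqP; ring. Qed.

Lemma le_Re_normc x : complex.Re x <= normc x.
Proof.
have := sqr_normcE x; have := normc_ge0 x; move: (normc x) => t t0 e; nra.
Qed.

Lemma sqr_normcD_le x y :
  normc (x + y) ^+ 2 <= 2 * normc x ^+ 2 + 2 * normc y ^+ 2.
Proof.
have := le_normcD x y; have := normc_ge0 (x + y).
have := sqr_ge0 (normc x - normc y); nra.
Qed.
End Modulus.

(** Uniform bound for bounded trace orbits whose first three terms are at most t:
the cubic expression dominates the Fricke-Vogt invariant. *)
Definition trace_bound (R : pzRingType) (t : R) : R := t + (3 * t ^+ 2 + t ^+ 3 + 13).

Section TraceOrbit.
Context {R : realType}.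
Variable x : nat -> R[i].
Hypothesis x_rec : forall k, x k.+3 = x k.+2 * x k.+1 - x k.
Local Notation y k := (normc (x k)).

Lemma trace_orbit_step k : y k.+2 * y k.+1 - y k <= y k.+3.
Proof. by rewrite x_rec -normcM; have := lerB_normcD (x k.+2 * x k.+1) (- x k);
  rewrite normcN. Qed.

(** The Fricke-Vogt invariant of the trace map. *)
Definition fricke_vogt k : R[i] :=
  x k ^+ 2 + x k.+1 ^+ 2 + x k.+2 ^+ 2 - x k * x k.+1 * x k.+2.

Lemma fricke_vogt_const k : fricke_vogt k = fricke_vogt 0.
Proof. by elim: k => [//|k <-]; rewrite /fricke_vogt x_rec; ring. Qed.

(** Two consecutive moduli of at least 2 + d that dominate the preceding one force
the next modulus to exceed their maximum by the factor 1 + d.  The configuration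
reproduces itself, and the orbit grows at least linearly. *)
Lemma trace_orbit_escape k : 2 < y k.+1 -> 2 < y k.+2 ->
  y k <= Num.max (y k.+1) (y k.+2) -> ~ exists B : R, forall n, y n <= B.
Proof.
move=> y1 y2 y0 [B yB].
have [d [d_gt0 d1 d2]] : exists d, [/\ 0 < d, 2 + d <= y k.+1 & 2 + d <= y k.+2].
  exists (Num.min (y k.+1) (y k.+2) - 2); rewrite subr_gt0 lt_min y1 y2.
  by rewrite addrC subrK !ge_min !lexx orbT.
have inv n : [/\ 2 + d <= y (k + n).+1, 2 + d <= y (k + n).+2,
    y (k + n)%N <= Num.max (y (k + n).+1) (y (k + n).+2) &
    2 + n%:R * d <= Num.max (y (k + n).+1) (y (k + n).+2)].
  elim: n => [|n [h1 h2 h0 hn]].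
    by rewrite addn0 mul0r addr0; split=> //; rewrite le_max (ltW y1).
  have h3 := trace_orbit_step (k + n).
  rewrite addnS; move: h0 h1 h2 h3 hn => /=.
  move: (normc (x (k + n))) (normc (x (k + n).+1)) (normc (x (k + n).+2))
    (normc (x (k + n).+3)) => p r s t h0 h1 h2 h3 hn.
  have rt : (1 + d) * Num.max r s <= t.
    by move: h0; case: (leP r s) => rs h0; nra.
  have m2 : 2 + d <= Num.max r s by rewrite le_max h1.
  have dm : 0 <= d * (Num.max r s - 2) by rewrite mulr_ge0; lra.
  have dn : 2 + n.+1%:R * d <= t by rewrite -natr1; lra.
  have mt : Num.max r s <= t by lra.
  have rt' : r <= t by apply: le_trans mt; rewrite le_max lexx.
  split=> //; rewrite ?le_max ?rt' ?dn ?orbT //.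
  by apply: le_trans mt; rewrite le_max h1.
have [n Bn] : exists n : nat, B < 2 + n%:R * d.
  exists (Num.bound (`|B| / d)).
  have /archi_boundP : 0 <= `|B| / d by rewrite divr_ge0 // ltW.
  rewrite ltr_pdivrMr // => h; have := ler_norm B; lra.
have [_ _ _] := inv n; rewrite leNgt => /negP[].
by apply: le_lt_trans Bn; rewrite ge_max !yB.
Qed.

Hypothesis x_bounded : exists B : R, forall n, y n <= B.

(** Contrapositive of the escape lemma, applied backwards: consecutive large traces
are preceded by larger ones down to the start of the orbit. *)
Lemma trace_orbit_descent k : 2 < y k.+1 -> 2 < y k.+2 ->
  y k.+1 < y 0 /\ y k.+2 < y 0.
Proof.
elim: k => [|k IH] y1 y2.
  have : ~ y 0 <= Num.max (y 1) (y 2) by move=> /(trace_orbit_escape y1 y2).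
  by move/negP; rewrite -ltNge gt_max => /andP[].
have : ~ y k.+1 <= Num.max (y k.+2) (y k.+3) by move=> /(trace_orbit_escape y1 y2).
move/negP; rewrite -ltNge gt_max => /andP[lt2 lt3].
have [lt0 _] := IH (lt_trans y1 lt2) y1.
by split; apply: lt_trans lt0.
Qed.

(** A large trace next to another large one is below x_0.  A large trace between two
traces of modulus at most 2 is a root of a quadratic equation whose
coefficients are bounded through the Fricke-Vogt invariant. *)
Lemma trace_orbit_bound (t : R) : y 0 <= t -> y 1 <= t -> y 2 <= t ->
  forall k, y k <= trace_bound t.
Proof.
move=> y0 y1 y2 k.
have t0 : 0 <= t by apply: le_trans (normc_ge0 _) y0.
have t2 : 0 <= t ^+ 2 by apply: exprn_ge0.
have t3 : 0 <= t ^+ 3 by apply: exprn_ge0.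
have B_t : t <= trace_bound t by rewrite /trace_bound; lra.
have B_2 : 2 <= trace_bound t by rewrite /trace_bound; lra.
case: k => [|k]; first exact: le_trans y0 B_t.
have [h1|h1] := leP (y k.+1) 2; first exact: le_trans h1 B_2.
have [h2|h2] := leP (y k.+2) 2; last first.
  by have [/ltW h _] := trace_orbit_descent h1 h2; apply: le_trans h (le_trans y0 B_t).
case: k h1 h2 => [|k] h1 h2; first exact: le_trans y1 B_t.
have [h0|h0] := leP (y k.+1) 2; last first.
  have [_ /ltW h] := trace_orbit_descent h0 h1; apply: le_trans h (le_trans y0 B_t).
have e : x k.+2 ^+ 2 = fricke_vogt 0 - (x k.+1 ^+ 2 + (x k.+3 ^+ 2 - x k.+1 * x k.+2 *
  x k.+3)).
  by rewrite -(fricke_vogt_const k.+1) /fricke_vogt; ring.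
have I0 : normc (fricke_vogt 0) <= 3 * t ^+ 2 + t ^+ 3.
  rewrite /fricke_vogt; apply: le_trans (ler_normcB _ _) _.
  have := le_normcD (x 0 ^+ 2 + x 1 ^+ 2) (x 2 ^+ 2).
  have := le_normcD (x 0 ^+ 2) (x 1 ^+ 2).
  rewrite !normcX !normcM.
  have sq i : y i <= t -> y i ^+ 2 <= t ^+ 2 by move=> h;
    rewrite lerXn2r // nnegrE ?normc_ge0.
  have := sq _ y0; have := sq _ y1; have := sq _ y2.
  have : y 0 * y 1 * y 2 <= t ^+ 3.
    by rewrite !exprS expr0 mulr1 mulrA; do !(apply: ler_pM;
      rewrite ?mulr_ge0 ?normc_ge0 //).
  lra.
have: y k.+2 ^+ 2 <= 3 * t ^+ 2 + t ^+ 3 + (4 + (4 + 4 * y k.+2)).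
  rewrite -normcX e; apply: le_trans (ler_normcB _ _) _.
  apply: lerD I0 _; apply: le_trans (le_normcD _ _) _.
  have sq i : y i <= 2 -> y i ^+ 2 <= 4.
    by move=> h; have := normc_ge0 (x i); nra.
  rewrite normcX; apply: lerD; first exact: sq.
  apply: le_trans (ler_normcB _ _) _; rewrite normcX; apply: lerD; first exact: sq.
  rewrite !normcM mulrAC ler_wpM2r ?normc_ge0 //.
  by have := normc_ge0 (x k.+1); have := normc_ge0 (x k.+3); nra.
rewrite /trace_bound; move: (normc_ge0 (x k.+2)); move: (normc (x k.+2)) => s; nra.
Qed.
End TraceOrbit.

(** * Growth of orbits from squares in the Fibonacci word *)

Definition sqr_norm2 (R : rcfType) (v : 'cV[R[i]]_2) : R :=
  normc (v 0 0) ^+ 2 + normc (v 1 0) ^+ 2.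

Section SquareNorm.
Context {R : rcfType}.
Implicit Types (v : 'cV[R[i]]_2) (t : R).

Lemma sqr_norm2_ge0 v : 0 <= sqr_norm2 v.
Proof. by rewrite addr_ge0 ?sqr_ge0. Qed.

Lemma sqr_norm2_mulmx (A : 'M[R[i]]_2) v t :
  (forall i j, normc (A i j) <= t) ->
  sqr_norm2 (A *m v) <= 4 * t ^+ 2 * sqr_norm2 v.
Proof.
move=> At; rewrite /sqr_norm2 !mulmx2E.
have row i : normc (A i 0 * v 0 0 + A i 1 * v 1 0) ^+ 2 <=
    2 * t ^+ 2 * normc (v 0 0) ^+ 2 + 2 * t ^+ 2 * normc (v 1 0) ^+ 2.
  apply: le_trans (sqr_normcD_le _ _) _.
  have sq j : normc (A i j) ^+ 2 <= t ^+ 2.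
    by rewrite lerXn2r ?At ?nnegrE ?normc_ge0 ?(le_trans _ (At i j)) ?normc_ge0.
  rewrite !normcM !exprMn.
  have := ler_wpM2r (sqr_ge0 (normc (v 0 0))) (sq 0).
  have := ler_wpM2r (sqr_ge0 (normc (v 1 0))) (sq 1); lra.
have := row 0; have := row 1; lra.
Qed.
End SquareNorm.

Lemma ler_sum_three_blocks (R : numDomainType) (f : nat -> R) (p n r m : nat) :
  (forall i, 0 <= f i) -> (n <= p + r)%N -> (p <= n)%N -> (n + r + r <= m)%N ->
  \sum_(p <= i < n) (f i + f (i + r)%N + f (i + r + r)%N) <= \sum_(p <= i < m) f i.
Proof.
move=> f0 nr pn nm; rewrite !big_split /=.
have sh k : \sum_(p <= i < n) f (i + k)%N = \sum_(p + k <= i < n + k) f i.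
  by rewrite big_addn addnK.
rewrite sh; under [X in _ + X]eq_bigr do rewrite -addnA.
rewrite sh addnA.
rewrite (@big_cat_nat _ _ _ n p m) //=; last by lia.
rewrite (@big_cat_nat _ _ _ (p + r) n m) //=; last by lia.
rewrite (@big_cat_nat _ _ _ (n + r) (p + r) m) //=; [|lia|lia].
rewrite (@big_cat_nat _ _ _ (p + r + r) (n + r) m) //=; [|lia|lia].
rewrite (@big_cat_nat _ _ _ (n + r + r) (p + r + r) m) //=; last by lia.
have pos k l : 0 <= \sum_(k <= i < l) f i by apply: sumr_ge0.
rewrite -!addrA lerD2l -subr_ge0.
rewrite [leRHS](_ : _ = \sum_(n <= i < p + r) f i + \sum_(n + r <= i < p + r + r) f i
  + \sum_(n + r + r <= i < m) f i); last by rewrite !addnA; ring.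
by rewrite !addr_ge0.
Qed.

Section FibonacciGrowth.
Context {R : realType}.
Variables (T : Type) (a b : T) (u : nat -> T) (g : T -> 'M[R[i]]_2).
Hypothesis hu : is_fibonacci_sequence a b u.
Hypothesis detg : forall n, \det (g (u n)) = 1.
Local Notation q := fib_length.
Local Notation N := (fun n => g (u n)).
Local Notation M := (fib_mx (g b) (g a)).
Local Notation x k := (\tr (M k)).

Section Lower.
Variables (X : nat -> 'cV[R[i]]_2) (p : nat) (B : R).
Hypothesis XN : forall i, (p <= i)%N -> X i.+1 = g (u i) *m X i.
Local Notation S n := (\sum_(p <= i < n) sqr_norm2 (X i)).

(** The factor gained by the sum of squares over four levels when the traces are
bounded by B. *)
Definition gordon_ratio : R := 1 + (2 * B ^+ 2 + 2)^-1.

Lemma gordon_ratio_gt1 : 1 < gordon_ratio.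
Proof. by rewrite /gordon_ratio ltrDl invr_gt0; have := sqr_ge0 B; lra. Qed.

(** Two equal consecutive blocks with matrix P give X_j = tr P X_(j+q) - X_(j+2q),
so the three vectors cannot decay together. *)
Lemma gordon_three_block k j : normc (x k.+2) <= B -> (p <= j)%N -> (j.+2 <= q k)%N ->
  sqr_norm2 (X j) <= (2 * B ^+ 2 + 2) *
    (sqr_norm2 (X (j + q k.+1)%N) + sqr_norm2 (X (j + q k.+1 + q k.+1)%N)).
Proof.
move=> xB pj jq; have [sqc trc] := fib_square hu detg jq.
set r := q k.+1; set P := cocycle N j r in sqc trc *.
have X1 : X (j + r)%N = P *m X j.
  by apply: cocycle_orbit => i /andP[ji _]; apply: XN; apply: leq_trans ji.
have X2 : X (j + r + r)%N = P *m X (j + r)%N.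
  rewrite -[in RHS]sqc; apply: cocycle_orbit => i /andP[ji _]; apply: XN.
  by apply: leq_trans ji; rewrite (leq_trans pj) ?leq_addr.
have detP : \det P = 1 by apply: det_cocycle.
have Xj : X j = x k.+2 *: X (j + r)%N - X (j + r + r)%N.
  rewrite X2 X1 mulmxA cayley_hamilton2 detP trc mulmxBl mul1mx -scalemxAl.
  by rewrite opprB addrC subrK.
have B0 : 0 <= B by apply: le_trans (normc_ge0 _) xB.
have row i : normc (X j i 0) ^+ 2 <= (2 * B ^+ 2 + 2) *
    (normc (X (j + r)%N i 0) ^+ 2 + normc (X (j + r + r)%N i 0) ^+ 2).
  rewrite Xj !mxE; apply: le_trans (sqr_normcD_le _ _) _.
  rewrite normcN normcM exprMn.
  have xB2 : normc (x k.+2) ^+ 2 <= B ^+ 2 by rewrite lerXn2r ?nnegrE ?normc_ge0.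
  have v0 := sqr_ge0 (normc (X (j + r)%N i 0)).
  have w0 := sqr_ge0 (normc (X (j + r + r)%N i 0)).
  have := ler_wpM2r v0 xB2; have := mulr_ge0 (sqr_ge0 B) w0; lra.
have := row 0; have := row 1; rewrite /sqr_norm2; lra.
Qed.

(** Summation of the three block inequality over j < q_k: the blocks shifted by
q_(k+2) and 2 q_(k+2) are disjoint from the first and end before q_(k+4). *)
Lemma gordon_step k : normc (x k.+3) <= B -> (p <= q k)%N ->
  gordon_ratio * S (q k) <= S (q k.+4).
Proof.
move=> xB pq.
have r_ge : (q k <= q k.+2)%N by apply: leq_fib_length; lia.
have c0 : 0 < 2 * B ^+ 2 + 2 by apply: ltr_wpDl => //; rewrite mulr_ge0 ?sqr_ge0.
have lr : (q k + q k.+2 + q k.+2 <= q k.+4)%N.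
  have : (q k <= q k.+1)%N by apply: leq_fib_length; lia.
  by rewrite !(fib_lengthSS k.+2) (fib_lengthSS k.+1); lia.
apply: le_trans (ler_sum_three_blocks (fun i => sqr_norm2_ge0 (X i)) _ pq lr);
  last by lia.
rewrite big_distrr /=; apply: ler_sum_nat => j /andP[pj jq].
rewrite -addrA /gordon_ratio mulrDl mul1r lerD2l mulrC ler_pdivrMr // [leRHS]mulrC.
apply: (gordon_three_block xB pj); apply: leq_ltn_trans jq _.
by case: (k) => // i;
  rewrite fib_lengthSS -[X in (X < _)%N]addn0 ltn_add2l fib_length_gt0.
Qed.

(** The starting index p is 0 for solutions on the half-line and 1 for resolvent
vectors, which satisfy the recursion only from index 1 on. *)
Lemma fib_orbit_growth n : (p <= 1)%N ->
  (forall k, (k <= 4 * n)%N -> normc (x k) <= B) ->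
  gordon_ratio ^+ n * sqr_norm2 (X p) <= S (q (4 * n).+1).
Proof.
move=> p1; elim: n => [_|n IH xB].
  rewrite expr0 mul1r muln0 /=.
  case: (p) p1 => [|[|//]] _; last by rewrite big_nat1.
  by rewrite big_nat_recl // lerDl big_nat1 sqr_norm2_ge0.
have -> : (4 * n.+1).+1 = (4 * n).+1.+4 by lia.
apply: le_trans (gordon_step _ _); last 2 first.
- by apply: xB; lia.
- by apply: leq_trans p1 (fib_length_gt0 _).
rewrite exprS -mulrA ler_wpM2l ?(ltW (lt_trans ltr01 gordon_ratio_gt1)) //.
by apply: IH => k kn; apply: xB; lia.
Qed.
End Lower.
End FibonacciGrowth.

(** * Polynomial upper bounds for Fibonacci cocycles *)

Section FibonacciUpper.
Context {R : realType}.
Variables (T : Type) (a b : T) (u : nat -> T) (g : T -> 'M[R[i]]_2).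
Hypothesis hu : is_fibonacci_sequence a b u.
Hypothesis detg : forall n, \det (g (u n)) = 1.
Local Notation q := fib_length.
Local Notation N := (fun n => g (u n)).
Local Notation M := (fib_mx (g b) (g a)).
Local Notation x k := (\tr (M k)).

Let deta : \det (g a) = 1. Proof. by rewrite -(fib_sequence0 hu). Qed.
Let detb : \det (g b) = 1. Proof. by rewrite -(fib_sequence1 hu). Qed.

Variables (B : R) (hB : forall k, normc (x k) <= B).
Let B_ge0 : 0 <= B. Proof. exact: le_trans (normc_ge0 _) (hB 0). Qed.
Local Notation D := (2 * B + 2).

(** Membership in the span of 1, M_k, M_(k+1), M_(k+2) with coefficients of modulus
at most t.  This span is stable under multiplication by M_(k+1). *)
Definition fib_span (k : nat) (t : R) (P : 'M[R[i]]_2) : Prop :=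
  exists c0 c1 c2 c3 : R[i],
    [/\ normc c0 <= t, normc c1 <= t, normc c2 <= t & normc c3 <= t] /\
    P = c0%:M + c1 *: M k + c2 *: M k.+1 + c3 *: M k.+2.

Lemma fib_span_weaken k t t' P : t <= t' -> fib_span k t P -> fib_span k t' P.
Proof.
move=> tt' [c0 [c1 [c2 [c3 [[h0 h1 h2 h3] ->]]]]].
by exists c0, c1, c2, c3; split=> //; split; apply: le_trans tt'.
Qed.

Lemma normc_lin_le (t : R) (c d : R[i]) k : normc c <= t -> normc d <= t ->
  normc (c + d * x k) <= D * t.
Proof.
move=> ct dt; apply: le_trans (le_normcD _ _) _; rewrite normcM.
have := ler_pM (normc_ge0 d) (normc_ge0 (x k)) dt (hB k).
have := normc_ge0 c; have := mulr_ge0 (le_trans (normc_ge0 _) ct) B_ge0; nra.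
Qed.

Lemma normc_comb_le (A1 A2 A3 : 'M[R[i]]_2) (c0 c1 c2 c3 : R[i]) (w v : R) i j :
  normc c0 <= w -> normc c1 <= w -> normc c2 <= w -> normc c3 <= w -> 1 <= v ->
  (forall i j, normc (A1 i j) <= v) -> (forall i j, normc (A2 i j) <= v) ->
  (forall i j, normc (A3 i j) <= v) ->
  normc ((c0%:M + c1 *: A1 + c2 *: A2 + c3 *: A3) i j) <= 4 * (w * v).
Proof.
move=> h0 h1 h2 h3 v1 a1 a2 a3; rewrite !mxE.
have w0 := le_trans (normc_ge0 _) h0.
have term c (A : 'M[R[i]]_2) : normc c <= w -> (forall i j, normc (A i j) <= v) ->
    normc (c * A i j) <= w * v.
  by move=> cw Av; rewrite normcM ler_pM ?normc_ge0.
have t0 : normc (c0 *+ (i == j)) <= w * v.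
  by apply: (@le_trans _ _ w); [case: (i == j);
    rewrite ?mulr1n ?mulr0n ?normc0|rewrite ler_peMr].
have := le_normcD (c0 *+ (i == j)) (c1 * A1 i j).
have := le_normcD (c0 *+ (i == j) + c1 * A1 i j) (c2 * A2 i j).
have := le_normcD (c0 *+ (i == j) + c1 * A1 i j + c2 * A2 i j) (c3 * A3 i j).
have := term _ _ h1 a1; have := term _ _ h2 a2; have := term _ _ h3 a3; lra.
Qed.

Lemma ler_fib_growth (t : R) : 0 <= t -> t <= D * t.
Proof. by move=> t0; have := mulr_ge0 t0 B_ge0; nra. Qed.

Lemma fib_span_shift k t P : fib_span k t P -> fib_span k.+1 (D * t) P.
Proof.
move=> [c0 [c1 [c2 [c3 [[h0 h1 h2 h3] ->]]]]].
have t0 := le_trans (normc_ge0 _) h0.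
exists (c0 + c1 * x k), (c2 + (- c1) * x k.+2), c3, c1.
split; first split.
- exact: normc_lin_le.
- by apply: normc_lin_le; rewrite ?normcN.
- exact: le_trans h3 (ler_fib_growth t0).
- exact: le_trans h1 (ler_fib_growth t0).
have := fib_mx_linear_rec deta detb k.
move: (M k.+3) => Y ->; apply: mx2P; rewrite !mxE /=; ring.
Qed.

Lemma fib_span_mulr k t P : fib_span k t P -> fib_span k (D * t) (P *m M k.+1).
Proof.
move=> [c0 [c1 [c2 [c3 [[h0 h1 h2 h3] ->]]]]].
have t0 := le_trans (normc_ge0 _) h0.
exists (- c2), (- c3), (c0 + c2 * x k.+1), (c1 + c3 * x k.+1).
split; first split; rewrite ?normcN.
- exact: le_trans h2 (ler_fib_growth t0).
- exact: le_trans h3 (ler_fib_growth t0).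
- exact: normc_lin_le.
- exact: normc_lin_le.
have := fib_mxSS (g a) (g b) k; have := fib_mx_sqr deta detb k.+1.
have := fib_mx_mulr deta detb k.
move: (M k) (M k.+1) (M k.+2) => U V W WV VV UV.
rewrite !mulmxDl mul_scalar_mx -!scalemxAl WV VV -UV.
by apply: mx2P; rewrite !mxE /=; ring.
Qed.

(** A prefix longer than q_k is s_k followed by a shorter prefix of the word, so its
matrix is a shorter product times M_(k+1).  Each such step costs a bounded
number of factors D. *)
Lemma fib_span_cocycle k m : (m <= q k)%N ->
  fib_span k (D ^+ (2 * k)) (cocycle N 0 m).
Proof.
have B0 := B_ge0; have D_ge1 : 1 <= D by lra.
have D0 : 0 <= D by lra.
suff: (forall m, (m <= q k)%N -> fib_span k (D ^+ (2 * k)) (cocycle N 0 m)) /\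
    (forall m, (m <= q k.+1)%N -> fib_span k.+1 (D ^+ (2 * k.+1)) (cocycle N 0 m)).
  by case=> + _; apply.
have unit01 : normc (0 : R[i]) <= 1 /\ normc (1 : R[i]) <= 1.
  by rewrite normc0 normc1 ler01.
have base i : (i <= 2)%N -> fib_span 0 1 (cocycle N 0 i).
  have [n0 n1] := unit01.
  case: i => [|[|[|//]]] _.
  - exists 1, 0, 0, 0; split=> //.
    by rewrite !scale0r !addr0.
  - exists 0, 0, 1, 0; split=> //.
    rewrite /= !add0n mulmx1 (fib_sequence0 hu) !scale0r scale1r !addr0.
    by rewrite (raddf0 (@scalar_mx _ 2)) add0r.
  - exists 0, 0, 0, 1; split=> //.
    rewrite /= !add0n mulmx1 (fib_sequence0 hu) (fib_sequence1 hu).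
    by rewrite !scale0r scale1r !addr0 (raddf0 (@scalar_mx _ 2)) add0r.
elim: k {m} => [|k [IH0 IH1]]; split=> //.
- by move=> m m1; rewrite muln0 expr0; apply: base; apply: leq_trans m1 _.
- move=> m m2; have /fib_span_shift := base m m2; apply: fib_span_weaken.
  by rewrite mulr1 muln1 expr2 ler_peMl.
move=> m; rewrite fib_lengthSS => mq.
have eD i : D ^+ (2 * i.+1) = D * D * D ^+ (2 * i) by rewrite mulnS !exprS mulrA.
have [mk|mk] := leqP m (q k.+1).
  have /fib_span_shift := IH1 m mk; apply: fib_span_weaken.
  by rewrite [leRHS]eD -mulrA ler_wpM2l // ler_peMl // exprn_ge0.
have -> : m = (q k.+1 + (m - q k.+1))%N by lia.
rewrite (fib_cocycleD g hu); last by lia.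
rewrite (fib_cocycleE g hu).
have /IH0/fib_span_shift/fib_span_mulr/fib_span_shift : (m - q k.+1 <= q k)%N by lia.
apply: fib_span_weaken.
by rewrite !eD -!mulrA; do 3!rewrite ler_wpM2l //; rewrite ler_peMl // exprn_ge0.
Qed.

Variables (G : R) (hGa : forall i j, normc (g a i j) <= G)
  (hGb : forall i j, normc (g b i j) <= G) (G_ge1 : 1 <= G).

Lemma fib_mx_entry_bound k i j : normc (M k i j) <= 2 * G ^+ 2 * D ^+ k.
Proof.
have G1 := G_ge1; have G0 : 0 <= G by lra.
have B0 := B_ge0; have D_ge1 : 1 <= D by lra.
have D0 : 0 <= D by lra.
have GG : G <= 2 * G ^+ 2 by nra.
have W0 : 1 <= 2 * G ^+ 2 by lra.
have expD n : 1 <= D ^+ n by rewrite exprn_ege1.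
suff H n : [/\ forall i j, normc (M n i j) <= 2 * G ^+ 2 * D ^+ n,
    forall i j, normc (M n.+1 i j) <= 2 * G ^+ 2 * D ^+ n.+1 &
    forall i j, normc (M n.+2 i j) <= 2 * G ^+ 2 * D ^+ n.+2].
  by have [] := H k.
elim: n => [|n [IH0 IH1 IH2]].
  have le_base n t : t <= 2 * G ^+ 2 -> t <= 2 * G ^+ 2 * D ^+ n.
    by move=> h; apply: le_trans h _; rewrite ler_peMr // (le_trans _ W0).
  split=> i' j'; apply: le_base; rewrite /=.
  - exact: le_trans GG.
  - exact: le_trans GG.
  rewrite mulmx2E; apply: le_trans (le_normcD _ _) _; rewrite !normcM.
  rewrite expr2 mulrDl mul1r; apply: lerD; apply: ler_pM; rewrite ?normc_ge0 //.
split=> // i' j'; rewrite (fib_mx_linear_rec deta detb) !mxE.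
apply: le_trans (ler_normcB _ _) _.
have hI : normc ((x n *+ (i' == j'))%R) <= B.
  by case: (i' == j'); rewrite ?mulr1n ?mulr0n ?normc0.
have h1 : normc (x n.+2 * M n.+1 i' j') <= B * (2 * G ^+ 2 * D ^+ n.+1).
  by rewrite normcM ler_pM ?normc_ge0.
have h0 := IH0 i' j'.
apply: le_trans (lerD (le_trans (le_normcD _ _) (lerD h1 h0)) hI) _.
have e1 : B <= B * (2 * G ^+ 2 * D ^+ n.+1).
  by rewrite ler_peMr // (le_trans W0) // ler_peMr // (le_trans _ W0).
have e0 : 2 * G ^+ 2 * D ^+ n <= 2 * G ^+ 2 * D ^+ n.+1.
  by rewrite ler_wpM2l ?(le_trans _ W0) // exprS ler_peMl // (le_trans _ (expD n)).
have e2 : 0 <= 2 * G ^+ 2 * D ^+ n.+1 by rewrite mulr_ge0 ?(le_trans _ W0) // (le_trans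
  _ (expD _)).
have e3 : D * (2 * G ^+ 2 * D ^+ n.+1) <= 2 * G ^+ 2 * D ^+ n.+3.
  rewrite mulrCA -exprS ler_wpM2l ?(le_trans _ W0) // [leRHS]exprS ler_peMl //.
  by rewrite (le_trans _ (expD _)).
by apply: le_trans e3; move: e0 e1 e2; move: (_ * D ^+ n.+1) => w; lra.
Qed.

Lemma fib_orbit_upper k m (X : nat -> 'cV[R[i]]_2) :
  (forall i, X i.+1 = N i *m X i) -> (m <= q k)%N ->
  sqr_norm2 (X m) <= 256 * G ^+ 4 * D ^+ 4 * (D ^+ 6) ^+ k * sqr_norm2 (X 0).
Proof.
move=> XN mq.
have B0 := B_ge0; have D_ge1 : 1 <= D by lra.
have D0 : 0 <= D by lra.
have expD n : 1 <= D ^+ n by rewrite exprn_ege1.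
have G1 := G_ge1; have W0 : 1 <= 2 * G ^+ 2 by nra.
have -> : X m = cocycle N 0 m *m X 0 by rewrite -[m in LHS]add0n; apply: cocycle_orbit.
apply: le_trans (@sqr_norm2_mulmx _ _ _ (8 * G ^+ 2 * D ^+ (3 * k).+2) _) _; last first.
  rewrite ler_wpM2r ?sqr_norm2_ge0 // le_eqVlt; apply/orP; left; apply/eqP.
  rewrite -exprM (_ : D ^+ (6 * k) = D ^+ (3 * k) * D ^+ (3 * k)); last first.
    by rewrite -exprD; congr (_ ^+ _); lia.
  by rewrite !exprS; ring.
move=> i j; have [c0 [c1 [c2 [c3 [[h0 h1 h2 h3] ->]]]]] := fib_span_cocycle mq.
set w := D ^+ (2 * k) in h0 h1 h2 h3.
have W : 8 * G ^+ 2 * D ^+ (3 * k).+2 = 4 * (w * (2 * G ^+ 2 * D ^+ k.+2)).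
  rewrite /w (_ : D ^+ (3 * k).+2 = D ^+ (2 * k) * D ^+ k.+2); first by ring.
  by rewrite -exprD; congr (_ ^+ _); lia.
set v := 2 * G ^+ 2 * D ^+ k.+2 in W.
have mono n : (n <= k.+2)%N -> 2 * G ^+ 2 * D ^+ n <= v.
  by move=> nk; rewrite ler_wpM2l ?(le_trans _ W0) // ler_weXn2l.
have v1 : 1 <= v by rewrite -[1]mulr1 ler_pM.
rewrite W; apply: normc_comb_le => // [i' j'|i' j'|i' j'];
  apply: le_trans (fib_mx_entry_bound _ _ _) (mono _ _) => //.
by rewrite -addn2 leq_addr.
Qed.
End FibonacciUpper.

(** * Perturbation of trace orbits and Szego matrices of determinant one *)

Section TracePerturbation.
Context {R : realType}.

(** The difference of two orbits grows by a factor of at most 2 B + 2 per step as long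
as the second orbit is bounded by B + 1, which holds while the difference
is at most 1. *)
Lemma trace_orbit_perturb (x y : nat -> R[i]) (B d : R) (n : nat) :
  (forall k, x k.+3 = x k.+2 * x k.+1 - x k) ->
  (forall k, y k.+3 = y k.+2 * y k.+1 - y k) ->
  (forall k, normc (x k) <= B) ->
  normc (x 0 - y 0) <= d -> normc (x 1 - y 1) <= d -> normc (x 2 - y 2) <= d ->
  (2 * B + 2) ^+ n * d <= 1 ->
  forall k, (k <= n)%N -> normc (y k) <= B + 1.
Proof.
move=> xr yr xB d0 d1 d2 dn.
have B0 : 0 <= B by apply: le_trans (normc_ge0 _) (xB 0).
have dpos : 0 <= d by apply: le_trans (normc_ge0 _) d0.
have D1 : 1 <= 2 * B + 2 by lra.
have mono k l : (k <= l)%N -> (2 * B + 2) ^+ k * d <= (2 * B + 2) ^+ l * d.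
  by move=> kl; rewrite ler_wpM2r // ler_weXn2l.
have small k : (k <= n)%N -> normc (x k - y k) <= (2 * B + 2) ^+ k * d ->
    normc (y k) <= B + 1.
  move=> kn h; have := le_trans h (le_trans (mono _ _ kn) dn).
  have := ler_normcB (x k) (x k - y k); rewrite opprB addrC subrK.
  by have := xB k; lra.
have dk k : (k <= n)%N -> normc (x k - y k) <= (2 * B + 2) ^+ k * d.
  have base k' : d <= (2 * B + 2) ^+ k' * d by rewrite -{1}[d]mul1r -(expr0 (2 * B +
    2)) mono.
  elim/ltn_ind: k => -[|[|[|k]]] IH kn; try exact: le_trans (base _).
  have e : x k.+3 - y k.+3 = x k.+2 * (x k.+1 - y k.+1) +
      (x k.+2 - y k.+2) * y k.+1 - (x k - y k) by rewrite xr yr; ring.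
  rewrite e; apply: le_trans (ler_normcB _ _) _.
  apply: le_trans (lerD (le_normcD _ _) (lexx _)) _; rewrite !normcM.
  have IHn i : (i <= k.+2)%N -> normc (x i - y i) <= (2 * B + 2) ^+ i * d.
    by move=> ik; apply: IH; rewrite ?ltnS // (leq_trans ik) // ltnW.
  have kS : (k <= k.+2)%N by rewrite ltnW.
  have h0 := le_trans (IHn k kS) (mono k k.+2 kS).
  have h1 := le_trans (IHn k.+1 (leqnSn _)) (mono _ _ (leqnSn _)).
  have h2 := IHn k.+2 (leqnn _).
  have y1 : normc (y k.+1) <= B + 1.
    by apply: small (IHn k.+1 (leqnSn _)); apply: leq_trans kn; rewrite ltnW.
  rewrite [leRHS](_ : _ = B * ((2 * B + 2) ^+ k.+2 * d) +
    (2 * B + 2) ^+ k.+2 * d * (B + 1) + (2 * B + 2) ^+ k.+2 * d);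
      last by rewrite exprS; ring.
  by apply: lerD => //; apply: lerD; apply: ler_pM; rewrite ?normc_ge0.
by move=> k kn; apply: small => //; apply: dk.
Qed.
End TracePerturbation.

Definition disk_rho (R : rcfType) (x : R[i]) : R := Num.sqrt (1 - normc x ^+ 2).

(** The Szego matrix at the energy s^2 divided by s, which has determinant 1.  For
|s| = 1 it lies in SU(1,1). *)
Definition unimodular_szego (R : rcfType) (s x : R[i]) : 'M[R[i]]_2 :=
  ((disk_rho x)%:C)^-1 *:
    \matrix_(i < 2, j < 2)
      nth 0 (nth [::] [:: [:: s; - x^* * s^-1 ]; [:: - x * s; s^-1 ]] i) j.

Section Szego.
Context {R : realType}.
Implicit Types s x : R[i].

Lemma disk_rho_gt0 x : unit_disk x -> 0 < disk_rho x.
Proof.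
move=> hx; rewrite sqrtr_gt0 subr_gt0 expr_lt1 ?normc_ge0 //; exact: hx.
Qed.

Lemma disk_rho_neq0 x : unit_disk x -> (disk_rho x)%:C != 0 :> R[i].
Proof. by move=> /disk_rho_gt0 h; rewrite eq_complex /= negb_and gt_eqF. Qed.

Lemma disk_rho_le1 x : disk_rho x <= 1.
Proof. by rewrite -sqrtr1 ler_wsqrtr // gerBl sqr_ge0. Qed.

Lemma disk_rho_sqr x : unit_disk x -> ((disk_rho x)%:C) ^+ 2 = 1 - x * x^*.
Proof.
move=> hx; rewrite mulc_conj -rmorphXn /= sqr_sqrtr ?rmorphB //=.
by rewrite subr_ge0 expr_le1 ?normc_ge0 // ltW.
Qed.

Lemma szego_normalize (alpha : int -> R[i]) (n : nat) s : s != 0 ->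
  szego_matrix alpha n (s ^+ 2) = s *: unimodular_szego s (alpha n%:Z).
Proof.
move=> s0; apply: mx2P; rewrite !mxE /= -/(disk_rho _);
  by move: ((disk_rho _)%:C^-1) => r; field.
Qed.

Lemma det_unimodular_szego s x : s != 0 -> unit_disk x ->
  \det (unimodular_szego s x) = 1.
Proof.
move=> s0 hx; have r0 := disk_rho_neq0 hx.
rewrite det2E !mxE /=.
have := disk_rho_sqr hx; move: (disk_rho x)%:C r0 => r r0 e.
by apply: (mulfI (expf_neq0 2 r0)); rewrite mulr1 {2}e; field; apply/andP.
Qed.

Lemma trace_szego s x :
  \tr (unimodular_szego s x) = ((disk_rho x)%:C)^-1 * (s + s^-1).
Proof. by rewrite mxtrace2E !mxE /= mulrDr. Qed.

Lemma trace_szego_mul s x y : s != 0 ->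
  \tr (unimodular_szego s x *m unimodular_szego s y) =
  ((disk_rho x)%:C)^-1 * ((disk_rho y)%:C)^-1 *
    (s ^+ 2 + s^-1 ^+ 2 + (x^* * y + x * y^*)).
Proof.
move=> s0; rewrite mxtrace2E !mulmx2E !mxE /=.
by move: ((disk_rho x)%:C^-1) ((disk_rho y)%:C^-1) => r r'; field.
Qed.
End Szego.

(** * Trace bounds for the Szego cocycle *)

Section SzegoTraces.
Context {R : realType}.
Variables (a b : R[i]) (alpha : int -> R[i]).
Hypotheses (ha : unit_disk a) (hb : unit_disk b)
  (halpha : forall n : int, unit_disk (alpha n))
  (hfib : is_fibonacci_sequence a b (fun n : nat => alpha n%:Z)).
Local Notation q := fib_length.
Local Notation g := unimodular_szego.
Local Notation x s k := (\tr (fib_mx (g s b) (g s a) k)).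

Definition szego_size : R := (disk_rho a)^-1 + (disk_rho b)^-1.
Local Notation K := szego_size.
Definition szego_trace_bound : R := trace_bound (4 * K ^+ 2).
Local Notation B := szego_trace_bound.

Lemma normc_disk_rhoV (y : R[i]) : unit_disk y -> normc ((disk_rho y)%:C^-1) =
  (disk_rho y)^-1.
Proof. by move=> /disk_rho_gt0 h; rewrite normcV normcR gtr0_norm. Qed.

Lemma disk_rhoV_ge1 (y : R[i]) : unit_disk y -> 1 <= (disk_rho y)^-1.
Proof. by move=> hy; rewrite invf_ge1 ?disk_rho_gt0 ?disk_rho_le1. Qed.

Lemma szego_size_ge1 : 1 <= K.
Proof. by rewrite /K; have := disk_rhoV_ge1 ha; have := disk_rhoV_ge1 hb; lra. Qed.

Lemma le_szego_size : (disk_rho a)^-1 <= K /\ (disk_rho b)^-1 <= K.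
Proof. by rewrite /K; have := disk_rhoV_ge1 ha; have := disk_rhoV_ge1 hb; lra. Qed.

Lemma szego_trace_bound_ge0 : 0 <= B.
Proof.
rewrite /B /trace_bound; have h : 0 <= 4 * K ^+ 2 by rewrite mulr_ge0 ?sqr_ge0.
by have := exprn_ge0 2 h; have := exprn_ge0 3 h; lra.
Qed.

Lemma circle_neq0 (s : R[i]) : normc s = 1 :> R -> s != 0.
Proof. by move=> h; apply/eqP => s0; move: h; rewrite s0 normc0 => /esym/eqP;
  rewrite oner_eq0. Qed.

Lemma szego_entry (s y : R[i]) i j : normc s = 1 -> unit_disk y ->
  normc (g s y i j) <= (disk_rho y)^-1.
Proof.
move=> s1 hy; have r0 := disk_rho_gt0 hy.
rewrite !mxE normcM normc_disk_rhoV // -[leRHS]mulr1 ler_wpM2l ?invr_ge0 ?(ltW r0) //.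
have y1 : normc y <= 1 by apply: ltW hy.
case: i => -[|[|//]] ? ; case: j => -[|[|//]] ? /=;
  by rewrite ?normcM ?normcV ?normcN ?normc_conj s1 ?invr1 ?mulr1 ?lexx.
Qed.

Lemma szego_fib_det s n : s != 0 -> \det (g s (alpha n)) = 1.
Proof. by move=> s0; apply: det_unimodular_szego. Qed.

Lemma szego_trace_rec s : s != 0 ->
  forall k, x s k.+3 = x s k.+2 * x s k.+1 - x s k.
Proof. by move=> s0 k; rewrite fib_mx_trace_rec // det_unimodular_szego. Qed.

Lemma szego_traces_initial s : normc s = 1 ->
  [/\ normc (x s 0) <= 4 * K ^+ 2, normc (x s 1) <= 4 * K ^+ 2 &
      normc (x s 2) <= 4 * K ^+ 2].
Proof.
move=> s1; have K1 := szego_size_ge1; have [Ka Kb] := le_szego_size.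
have K2 : 2 * K <= 4 * K ^+ 2 by nra.
have tr1 y : unit_disk y -> (disk_rho y)^-1 <= K -> normc (\tr (g s y)) <= 2 * K.
  move=> hy yK; rewrite trace_szego normcM normc_disk_rhoV // mulrC.
  apply: ler_pM; rewrite ?normc_ge0 ?invr_ge0 ?(ltW (disk_rho_gt0 hy)) //.
  by have := le_normcD s s^-1; rewrite normcV s1 invr1.
split; rewrite /=; [exact: le_trans (tr1 _ hb Kb) K2|exact: le_trans (tr1 _ ha Ka) K2|].
rewrite trace_szego_mul ?circle_neq0 // !normcM !normc_disk_rhoV // mulrC expr2.
apply: ler_pM; rewrite ?normc_ge0 ?mulr_ge0 ?invr_ge0 ?(ltW (disk_rho_gt0 _)) //;
  last first.
  by rewrite ler_pM ?invr_ge0 ?(ltW (disk_rho_gt0 _)).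
have ab : normc a * normc b <= 1 by rewrite mulr_ile1 ?normc_ge0 ?(ltW ha) ?(ltW hb).
apply: le_trans (le_normcD _ _) _.
have := le_normcD (s ^+ 2) (s^-1 ^+ 2); have := le_normcD (b^* * a) (b * a^*).
rewrite !normcX normcV s1 invr1 !expr1n !normcM !normc_conj [normc b * _]mulrC; lra.
Qed.

Lemma transfer_matrix_cocycle s n : s != 0 ->
  transfer_matrix alpha n (s ^+ 2) =
  s ^+ n *: cocycle (fun n : nat => g s (alpha n%:Z)) 0 n.
Proof.
move=> s0; elim: n => [|n IH]; first by rewrite expr0 scale1r.
rewrite [LHS]/= IH szego_normalize // -scalemxAr -scalemxAl scalerA.
by rewrite -exprSr.
Qed.

Lemma szego_trace_bounded s : normc s = 1 -> bounded_trace_set alpha (s ^+ 2) ->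
  forall k, normc (x s k) <= B.
Proof.
move=> s1 [_ [t ht]]; have s0 := circle_neq0 s1.
have [i0 i1 i2] := szego_traces_initial s1.
apply: trace_orbit_bound => //; first exact: szego_trace_rec.
exists (Num.max (normc (x s 0)) t) => -[|k]; rewrite le_max ?lexx //.
apply/orP; right; have := ht k; rewrite transfer_matrix_cocycle // mxtraceZ normcM.
rewrite normcX s1 expr1n mul1r.
by rewrite (fib_cocycleE (g s) hfib).
Qed.

(** The three initial traces are Laurent polynomials in s, hence within
10 K^2 e of each other for s on the circle and (1 - e) s. *)
Lemma szego_trace_near s e n : normc s = 1 -> bounded_trace_set alpha (s ^+ 2) ->
  0 < e <= 2^-1 -> (2 * B + 2) ^+ n * (10 * K ^+ 2 * e) <= 1 ->
  forall k, (k <= n)%N -> normc (x ((1 - e)%:C * s) k) <= B + 1.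
Proof.
move=> s1 hs /andP[e0 e1] small; set t := (1 - e)%:C * s.
have K1 := szego_size_ge1; have [Ka Kb] := le_szego_size.
have s0 := circle_neq0 s1.
have r0 : (1 - e)%:C != 0 :> R[i] by rewrite eq_complex /= negb_and gt_eqF //; lra.
have t0 : t != 0 by rewrite mulf_neq0.
have iE : (1 - e)^-1 <= 2.
  by rewrite -[2]invrK lef_pV2 ?posrE; lra.
have iE1 : 1 <= (1 - e)^-1 by rewrite invf_ge1; lra.
have iV : (1 - e)^-1 - 1 = e * (1 - e)^-1 by field; rewrite gt_eqF //; lra.
have dst : normc (s - t) = e.
  rewrite (_ : s - t = e%:C * s); first by rewrite normcM s1 normcR gtr0_norm ?mulr1.
  by rewrite /t rmorphB rmorph1; ring.
have dst2 : normc (s ^+ 2 - t ^+ 2) <= 2 * e.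
  rewrite subr_sqr normcM dst mulrC ler_wpM2r ?(ltW e0) //.
  apply: le_trans (le_normcD _ _) _; rewrite s1 /t normcM s1 normcR ger0_norm; lra.
have dV : normc (s^-1 - t^-1) <= 2 * e.
  rewrite (_ : s^-1 - t^-1 = - (s^-1 * (((1 - e)^-1 - 1)%:C))); last first.
    have -> : ((1 - e)^-1 - 1)%:C = (1 - e)%:C^-1 - 1.
      by rewrite rmorphB rmorph1 (fmorphV (real_complex R)).
    rewrite /t.
    by move: ((1 - e)%:C) r0 => r r0; field; rewrite r0 s0.
  rewrite normcN normcM normcV s1 invr1 mul1r normcR ger0_norm; last by lra.
  by rewrite iV mulrC ler_wpM2r // (ltW e0).
have dV2 : normc (s^-1 ^+ 2 - t^-1 ^+ 2) <= 6 * e.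
  rewrite subr_sqr normcM mulrC (_ : 6 * e = 3 * (2 * e)); last by ring.
  apply: ler_pM; rewrite ?normc_ge0 //.
  apply: le_trans (le_normcD _ _) _; rewrite !normcV s1 /t normcM s1 normcR mulr1 invr1.
  by rewrite ger0_norm; lra.
have tr1 y : unit_disk y -> (disk_rho y)^-1 <= K ->
    normc (\tr (g s y) - \tr (g t y)) <= 10 * K ^+ 2 * e.
  move=> hy yK; rewrite !trace_szego -mulrBr normcM normc_disk_rhoV //.
  rewrite (_ : s + s^-1 - (t + t^-1) = (s - t) + (s^-1 - t^-1)); last by ring.
  have h : normc (s - t + (s^-1 - t^-1)) <= 3 * e.
    by apply: le_trans (le_normcD _ _) _; rewrite dst; lra.
  apply: (@le_trans _ _ (K * (3 * e))).
    by apply: ler_pM; rewrite ?normc_ge0 ?invr_ge0 ?(ltW (disk_rho_gt0 hy)).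
  have : 0 <= e * (10 * K ^+ 2 - 3 * K) by rewrite mulr_ge0; [|lra|nra].
  lra.
apply: (@trace_orbit_perturb _ (fun k => x s k) (fun k => x t k) B _ n) small => /=.
- exact: szego_trace_rec.
- exact: szego_trace_rec.
- exact: szego_trace_bounded.
- exact: tr1.
- exact: tr1.
rewrite !trace_szego_mul // -mulrBr normcM.
set w := _ - _ ; have -> : w = (s ^+ 2 - t ^+ 2) + (s^-1 ^+ 2 - t^-1 ^+ 2).
  by rewrite /w; ring.
have h : normc (s ^+ 2 - t ^+ 2 + (s^-1 ^+ 2 - t^-1 ^+ 2)) <= 10 * e.
  by apply: le_trans (le_normcD _ _) _; lra.
rewrite (_ : 10 * K ^+ 2 * e = K * K * (10 * e)); last by ring.
rewrite normcM !normc_disk_rhoV // ; apply: ler_pM; rewrite ?normc_ge0 //.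
  by rewrite mulr_ge0 ?invr_ge0 ?(ltW (disk_rho_gt0 _)).
by rewrite ler_pM ?invr_ge0 ?(ltW (disk_rho_gt0 _)).
Qed.
End SzegoTraces.

(** * From geometric growth to power laws *)

Section PowerLaw.
Context {R : realType}.
Implicit Types (c l L : R) (eta : nat -> R[i]).
Local Notation q := fib_length.

(** The power law exponent of norms whose squares grow by the factor l when the length
grows by the factor c; the 2 in the denominator accounts for the squares. *)
Definition geometric_exponent c l : R := ln l / (2 * ln c).

Lemma sqr_powR_geometric c l n : 1 < c -> 0 < l ->
  ((c ^+ n) `^ geometric_exponent c l) ^+ 2 = l ^+ n.
Proof.
move=> c1 l0; have c0 : 0 < c by apply: lt_trans c1.
rewrite -powR_mulrn ?powR_ge0 // -powRrM /powR gt_eqF ?exprn_gt0 // lnXn //.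
rewrite -[in RHS](lnK l0) -expRM_natl; congr expR.
by rewrite /geometric_exponent -mulr_natl; field; rewrite gt_eqF // ln_gt0.
Qed.

Lemma geometric_exponent_gt0 c l : 1 < c -> 1 < l -> 0 < geometric_exponent c l.
Proof. by move=> c1 l1; rewrite divr_gt0 ?mulr_gt0 ?ln_gt0. Qed.

Lemma le_norm_upto eta m n : (m <= n)%N -> norm_upto eta m <= norm_upto eta n.
Proof.
move=> mn; rewrite ler_wsqrtr // -!(big_mkord xpredT (fun j => normc (eta j) ^+ 2)).
rewrite (@big_cat_nat _ _ _ m.+1 0 n.+1) //= lerDl.
by apply: sumr_ge0 => i _; rewrite sqr_ge0.
Qed.

Lemma norm_at_itv eta L : 0 <= L ->
  norm_upto eta (Num.truncn L) <= norm_at eta L <= norm_upto eta (Num.truncn L).+1.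
Proof.
move=> L0; have /andP[h1 h2] := truncn_itv L0; rewrite /norm_at.
have h3 := le_norm_upto eta (leqnSn (Num.truncn L)); rewrite -natr1 in h2.
move: (norm_upto eta (Num.truncn L)) (norm_upto eta (Num.truncn L).+1) h3 => n0 n1 h3.
have p1 : 0 <= (L - (Num.truncn L)%:R) * (n1 - n0) by rewrite mulr_ge0 // subr_ge0.
have p2 : 0 <= (1 - (L - (Num.truncn L)%:R)) * (n1 - n0).
  by rewrite mulr_ge0 // subr_ge0 //; move: h2; lra.
by apply/andP; split; lra.
Qed.

(** The sums of squares are known at the lengths q_(4i+1), which are at most
2 * 16^i; the constant 64 covers the lengths in between. *)
Lemma norm_at_lower eta l L : 1 < l -> 4 <= L ->
  (forall i, l ^+ i <= \sum_(j < 2 * q (4 * i).+1) normc (eta j) ^+ 2) ->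
  64 `^ (- geometric_exponent 16 l) * L `^ geometric_exponent 16 l <= norm_at eta L.
Proof.
move=> l1 L4 hl; set gam := geometric_exponent 16 l.
have g0 : 0 <= gam by apply/ltW/geometric_exponent_gt0 => //; lra.
have L0 : 0 <= L by lra.
have /andP[le1 _] := norm_at_itv eta L0; apply: le_trans le1.
have /andP[nL Ln] := truncn_itv L0.
set n := Num.truncn L in nL Ln *.
have n4 : (4 <= n)%N by rewrite -ltnS -(ltr_nat R); apply: le_lt_trans Ln.
(* The first q_(4 i + 1) vectors fit into n + 1 entries since
   2 q_(4 i + 1) <= 4 * 16 ^ i <= n. *)
pose i := trunc_log 16 (n %/ 4).
have h1 : (16 ^ i <= n %/ 4)%N by apply: trunc_logP => //; rewrite divn_gt0.
have h2 : (n %/ 4 < 16 ^ i.+1)%N by apply: trunc_log_ltn.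
have iq : (2 * q (4 * i).+1 <= n.+1)%N.
  have := fib_length_upper (4 * i).+1; rewrite expnS expnM.
  by move: h1; rewrite -[(2 ^ 4)%N]/16%N; lia.
have Li : L <= 64 * 16 ^+ i.
  apply: (le_trans (ltW Ln)); rewrite -natrX -natrM ler_nat.
  by move: h2; rewrite expnS; lia.
apply: (@le_trans _ _ ((16 ^+ i) `^ gam)).
  rewrite powRN mulrC ler_pdivrMr ?powR_gt0 // -powRM ?exprn_ge0 //.
  by apply: ge0_ler_powR => //; rewrite ?nnegrE ?mulr_ge0 ?exprn_ge0 // mulrC.
rewrite -[leLHS]ger0_norm ?powR_ge0 // -sqrtr_sqr ler_wsqrtr //.
rewrite sqr_powR_geometric ?(lt_trans ltr01) //; last by lra.
apply: le_trans (hl i) _.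
rewrite -!(big_mkord xpredT (fun j => normc (eta j) ^+ 2)).
rewrite [leRHS](@big_cat_nat _ _ _ (2 * q (4 * i).+1) 0 n.+1) //= lerDl.
by apply: sumr_ge0 => j _; rewrite sqr_ge0.
Qed.

Lemma norm_at_upper eta (A l : R) L : 1 < l -> 0 <= A -> 1 <= L ->
  (forall i, \sum_(j < 2 * q (2 * i)) normc (eta j) ^+ 2 <= A * l ^+ i) ->
  norm_at eta L <= Num.sqrt (A * l) * L `^ geometric_exponent 2 l.
Proof.
move=> l1 A0 L1 hl; set gam := geometric_exponent 2 l.
have g0 : 0 <= gam by apply/ltW/geometric_exponent_gt0 => //; lra.
have L0 : 0 <= L by lra.
have /andP[_ le1] := norm_at_itv eta L0; apply: (le_trans le1).
have /andP[nL Ln] := truncn_itv L0.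
set n := Num.truncn L in nL Ln *.
have n1 : (1 <= n)%N by rewrite -ltnS -(ltr_nat R); apply: le_lt_trans Ln.
pose i := trunc_log 2 n.
have h1 : (2 ^ i <= n)%N by apply: trunc_logP.
have h2 : (n < 2 ^ i.+1)%N by apply: trunc_log_ltn.
have iq : (n.+2 <= 2 * q (2 * i.+1))%N by have := fib_length_lower i.+1; lia.
have l0 : 0 < l by lra.
apply: (@le_trans _ _ (Num.sqrt (A * l) * (2 ^+ i) `^ gam)); last first.
  rewrite ler_wpM2l ?sqrtr_ge0 //; apply: ge0_ler_powR => //.
  - by rewrite nnegrE exprn_ge0.
  - by apply: le_trans nL; rewrite -natrX ler_nat.
rewrite -[X in _ * X]ger0_norm ?powR_ge0 // -sqrtr_sqr -sqrtrM;
  last by rewrite mulr_ge0 // ltW.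
rewrite ler_wsqrtr // sqr_powR_geometric //; last by lra.
rewrite -mulrA -exprS; apply: le_trans (hl _).
rewrite -!(big_mkord xpredT (fun j => normc (eta j) ^+ 2)).
rewrite [leRHS](@big_cat_nat _ _ _ n.+2 0) //= lerDl.
by apply: sumr_ge0 => j _; rewrite sqr_ge0.
Qed.
End PowerLaw.

(** * Power laws for solutions of the transfer matrix recursion *)

Section SolutionGrowth.
Context {R : realType}.
Variables (a b : R[i]) (alpha : int -> R[i]).
Hypotheses (ha : unit_disk a) (hb : unit_disk b)
  (halpha : forall n : int, unit_disk (alpha n))
  (hfib : is_fibonacci_sequence a b (fun n : nat => alpha n%:Z)).
Local Notation q := fib_length.
Local Notation K := (szego_size a b).
Local Notation B := (szego_trace_bound a b).
Local Notation D := (2 * B + 2).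

(** Dividing by s^n turns the recursion into the one with determinant 1. *)
Definition solution_vector (s : R[i]) (eta : nat -> R[i]) (n : nat) : 'cV[R[i]]_2 :=
  s^-1 ^+ n *: \col_(i < 2) [:: eta (2 * n + 1)%N; eta (2 * n)%N]`_i.

Definition solution_upper_ratio : R := 4 * D ^+ 12.
Definition solution_upper_const : R := 512 * K ^+ 4 * D ^+ 4.

Lemma solution_upper_ratio_gt1 : 1 < solution_upper_ratio.
Proof.
have : 1 <= D ^+ 12 by apply: exprn_ege1; have := szego_trace_bound_ge0 a b; lra.
by rewrite /solution_upper_ratio; lra.
Qed.

Lemma solution_upper_const_gt0 : 0 < solution_upper_const.
Proof.
rewrite /solution_upper_const; apply: mulr_gt0; first apply: mulr_gt0 => //.
  by apply: exprn_gt0; have := szego_size_ge1 ha hb; lra.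
by apply: exprn_gt0; have := szego_trace_bound_ge0 a b; lra.
Qed.

Variables (s : R[i]) (eta : nat -> R[i]).
Hypotheses (s1 : normc s = 1) (hs : bounded_trace_set alpha (s ^+ 2))
  (heta : transfer_solution alpha (s ^+ 2) eta) (eta1 : normalized eta).
Local Notation X := (solution_vector s eta).

Lemma sqr_norm2_solution n :
  sqr_norm2 (X n) = normc (eta (2 * n)%N) ^+ 2 + normc (eta (2 * n).+1) ^+ 2.
Proof.
by rewrite /sqr_norm2 !mxE /= !normcM !normcX normcV s1 invr1 expr1n !mul1r addn1 addrC.
Qed.

Lemma sum_solution m : \sum_(j < 2 * m) normc (eta j) ^+ 2 =
  \sum_(0 <= n < m) sqr_norm2 (X n).
Proof.
rewrite big_mkord; elim: m => [|m IH]; first by rewrite muln0 !big_ord0.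
rewrite (_ : (2 * m.+1 = (2 * m).+2)%N); last by lia.
by rewrite !big_ord_recr /= IH sqr_norm2_solution addrA.
Qed.

Lemma solution_step n : X n.+1 = unimodular_szego s (alpha n%:Z) *m X n.
Proof.
have s0 := circle_neq0 s1.
have := heta n; rewrite szego_normalize // /solution_vector => e.
rewrite (_ : 2 * n.+1 + 1 = 2 * n + 3)%N; last by lia.
rewrite (_ : 2 * n.+1 = 2 * n + 2)%N; last by lia.
rewrite e -scalemxAl -scalemxAr !scalerA exprSr -mulrA mulVf // mulr1 //.
Qed.

Lemma solution_lower i : gordon_ratio B ^+ i <=
  \sum_(j < 2 * q (4 * i).+1) normc (eta j) ^+ 2.
Proof.
have s0 := circle_neq0 s1.
have g1 : 0 <= gordon_ratio B by apply/ltW/(lt_trans ltr01)/gordon_ratio_gt1.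
rewrite sum_solution.
have := @fib_orbit_growth _ _ _ _ _ (unimodular_szego s) hfib
  (fun n => szego_fib_det halpha n%:Z s0) X 0 B _ i isT _.
rewrite [sqr_norm2 _]sqr_norm2_solution muln0 eta1 => h.
apply: le_trans (h _ _); last 2 first.
- by move=> n _; exact: solution_step.
- by move=> k _; exact: szego_trace_bounded.
by rewrite ler_peMr ?exprn_ge0 //; lra.
Qed.

Lemma solution_upper i : \sum_(j < 2 * q (2 * i)) normc (eta j) ^+ 2 <=
  solution_upper_const * solution_upper_ratio ^+ i.
Proof.
have s0 := circle_neq0 s1; have B0 := szego_trace_bound_ge0 a b.
have K1 := szego_size_ge1 ha hb; have [Ka Kb] := le_szego_size ha hb.
rewrite sum_solution.
have D0 : 0 <= D by lra.
set c := 512 * K ^+ 4 * D ^+ 4 * (D ^+ 6) ^+ (2 * i).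
have c0 : 0 <= c by rewrite !mulr_ge0 ?exprn_ge0 //; lra.
have le_c n : (n < q (2 * i))%N -> sqr_norm2 (X n) <= c.
  move=> /ltnW nq.
  have := @fib_orbit_upper _ _ _ _ _ (unimodular_szego s) hfib
    (fun n => szego_fib_det halpha n%:Z s0) B _ K _ _ K1 _ n X solution_step nq.
  rewrite [sqr_norm2 (X 0)]sqr_norm2_solution muln0 eta1 => h.
  apply: le_trans (h _ _ _) _.
  - by move=> k; exact: szego_trace_bounded.
  - by move=> k l; apply: le_trans (szego_entry _ _ s1 ha) Ka.
  - by move=> k l; apply: le_trans (szego_entry _ _ s1 hb) Kb.
  by rewrite le_eqVlt; apply/orP; left; apply/eqP; rewrite /c; ring.
apply: (@le_trans _ _ (\sum_(0 <= n < q (2 * i)) c)).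
  by apply: ler_sum_nat => n /andP[_]; exact: le_c.
rewrite sumr_const_nat subn0 -[_ *+ _]mulr_natr.
apply: (@le_trans _ _ (c * (2 ^+ (2 * i)))).
  by rewrite ler_wpM2l // -natrX ler_nat fib_length_upper.
rewrite /c /solution_upper_const /solution_upper_ratio -exprM.
rewrite -mulrA ler_wpM2l ?(ltW solution_upper_const_gt0) //.
rewrite exprMn (_ : (6 * (2 * i) = 12 * i)%N); last by lia.
by rewrite exprM (exprM 2 2) mulrC (_ : 2 ^+ 2 = 4) //; ring.
Qed.
End SolutionGrowth.

(** * The extended CMV matrix as a product of two block unitaries *)

Section Cmv.
Context {R : realType}.
Variable alpha : int -> R[i].
Hypothesis halpha : forall n : int, unit_disk (alpha n).
Implicit Types (u : int -> R[i]) (m : int).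
Local Notation r n := ((disk_rho (alpha n))%:C).

Lemma divz2_even m : (2 * m %/ 2)%Z = m. Proof. by lia. Qed.
Lemma divz2_odd m : ((2 * m + 1) %/ 2)%Z = m. Proof. by lia. Qed.

(** The second factor of E = L M applied to u.  M acts by unitary blocks on
the pairs (2m - 1, 2m) and L on the pairs (2m, 2m + 1). *)
Definition cmv_half u (k : int) : R[i] :=
  let m := (k %/ 2)%Z in
  if k == 2 * m then r (k - 1) * u (k - 1) - alpha (k - 1) * u k
  else (alpha k)^* * u k + r k * u (k + 1).

Lemma cmv_half_even u m : cmv_half u (2 * m) =
  r (2 * m - 1) * u (2 * m - 1) - alpha (2 * m - 1) * u (2 * m).
Proof. by rewrite /cmv_half divz2_even eqxx. Qed.

Lemma cmv_half_odd u m : cmv_half u (2 * m + 1) =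
  (alpha (2 * m + 1))^* * u (2 * m + 1) + r (2 * m + 1) * u (2 * m + 2).
Proof.
rewrite /cmv_half divz2_odd ifF; last by apply/eqP; lia.
by rewrite -addrA.
Qed.

Lemma cmv_op_row u j : cmv_op alpha u j = let m := (j %/ 2)%Z in
  cmv alpha j (2 * m - 1) * u (2 * m - 1) + cmv alpha j (2 * m) * u (2 * m) +
  cmv alpha j (2 * m + 1) * u (2 * m + 1) + cmv alpha j (2 * m + 2) * u (2 * m + 2).
Proof.
set m := (j %/ 2)%Z; pose l := [:: 2 * m - 1; 2 * m; 2 * m + 1; 2 * m + 2].
have ul : uniq l by rewrite /= !inE !negb_or; lia.
rewrite /cmv_op -(fsbig_widen [set` l] [set: int]) //.
  by rewrite -fsbig_seq // /l !big_cons big_nil /= addr0 !addrA.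
move=> k [_ /= /negP]; rewrite !inE !negb_or => /and4P[k1 k2 k3 k4].
by rewrite /cmv -/m !(negbTE k1, negbTE k2, negbTE k3, negbTE k4) if_same mul0r.
Qed.

Lemma cmv_op_even u m : cmv_op alpha u (2 * m) =
  (alpha (2 * m))^* * cmv_half u (2 * m) + r (2 * m) * cmv_half u (2 * m + 1).
Proof.
rewrite cmv_op_row /= divz2_even cmv_half_even cmv_half_odd /cmv divz2_even !eqxx.
have -> : (2 * m == 2 * m - 1) = false by apply/eqP; lia.
have -> : (2 * m + 1 == 2 * m - 1) = false by apply/eqP; lia.
have -> : (2 * m + 2 == 2 * m - 1) = false by apply/eqP; lia.
have -> : (2 * m + 1 == 2 * m) = false by apply/eqP; lia.
have -> : (2 * m + 2 == 2 * m) = false by apply/eqP; lia.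
have -> : (2 * m + 2 == 2 * m + 1) = false by apply/eqP; lia.
rewrite -![rho _ _]/(disk_rho _); ring.
Qed.

Lemma cmv_op_odd u m : cmv_op alpha u (2 * m + 1) =
  r (2 * m) * cmv_half u (2 * m) - alpha (2 * m) * cmv_half u (2 * m + 1).
Proof.
rewrite cmv_op_row /= divz2_odd cmv_half_even cmv_half_odd /cmv divz2_odd !eqxx.
have -> : (2 * m == 2 * m - 1) = false by apply/eqP; lia.
have -> : (2 * m + 1 == 2 * m - 1) = false by apply/eqP; lia.
have -> : (2 * m + 2 == 2 * m - 1) = false by apply/eqP; lia.
have -> : (2 * m + 1 == 2 * m) = false by apply/eqP; lia.
have -> : (2 * m + 2 == 2 * m) = false by apply/eqP; lia.
have -> : (2 * m + 2 == 2 * m + 1) = false by apply/eqP; lia.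
rewrite -![rho _ _]/(disk_rho _); ring.
Qed.

Lemma szego_block_isometry (x p p' : R[i]) : unit_disk x ->
  normc (x^* * p + (disk_rho x)%:C * p') ^+ 2 +
  normc ((disk_rho x)%:C * p - x * p') ^+ 2 = normc p ^+ 2 + normc p' ^+ 2.
Proof.
move=> hx; have x1 : normc x ^+ 2 <= 1 by rewrite expr_le1 ?normc_ge0 // ltW.
have : disk_rho x ^+ 2 = 1 - normc x ^+ 2 by rewrite sqr_sqrtr // subr_ge0.
move: (disk_rho x) => t; rewrite !sqr_normcE.
case: x {hx x1} => x1 x2; case: p => p1 p2; case: p' => p1' p2' /= e.
ring: e.
Qed.

Lemma add_two_pairs (V : zmodType) (S f0 g0 f1 g1 f0' g0' f1' g1' : V) :
  f0 + f1 = f0' + f1' -> g0 + g1 = g0' + g1' ->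
  S + (f0 + g0) + (f1 + g1) = S + (f0' + g0') + (f1' + g1').
Proof.
by move=> hf hg; rewrite -!addrA; congr (S + _);
  rewrite !addrA !(addrAC _ _ f1) !(addrAC _ _ f1') hf -!addrA hg.
Qed.

(** The sum of squares over the symmetric window -n <= k < n.  Windows of even
half-length are unions of the pairs (2m, 2m + 1), those of odd half-length of
the pairs (2m - 1, 2m), so L and M are seen to be isometric without passing to
infinite sums. *)
Definition sqr_window u (n : nat) : R :=
  \sum_(i < n) (normc (u i%:Z) ^+ 2 + normc (u (- i%:Z - 1)) ^+ 2).

Lemma sqr_windowS u n : sqr_window u n.+1 =
  sqr_window u n + (normc (u n%:Z) ^+ 2 + normc (u (- n%:Z - 1)) ^+ 2).
Proof. by rewrite /sqr_window big_ord_recr. Qed.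

Lemma sqr_window_even u v n :
  (forall m, normc (u (2 * m)) ^+ 2 + normc (u (2 * m + 1)) ^+ 2 =
             normc (v (2 * m)) ^+ 2 + normc (v (2 * m + 1)) ^+ 2) ->
  sqr_window u (2 * n) = sqr_window v (2 * n).
Proof.
move=> uv; elim: n => [|n IH]; first by rewrite muln0 /sqr_window !big_ord0.
rewrite (_ : (2 * n.+1 = (2 * n).+2)%N); last by lia.
rewrite !sqr_windowS IH.
have e0 : (2 * n)%N = 2 * n%:Z :> int by lia.
have e1 : (2 * n).+1 = 2 * n%:Z + 1 :> int by lia.
have e2 : 2 * (- n%:Z - 1) + 1 = - (2 * n%:Z) - 1 :> int by lia.
have e3 : 2 * (- n%:Z - 1) = - (2 * n%:Z + 1) - 1 :> int by lia.
have := uv n%:Z; have := uv (- n%:Z - 1); rewrite e2 e3 e0 e1 => h h'.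
by apply: add_two_pairs => //; rewrite addrC h addrC.
Qed.

Lemma sqr_window_odd u v n :
  (forall m, normc (u (2 * m - 1)) ^+ 2 + normc (u (2 * m)) ^+ 2 =
             normc (v (2 * m - 1)) ^+ 2 + normc (v (2 * m)) ^+ 2) ->
  sqr_window u (2 * n).+1 = sqr_window v (2 * n).+1.
Proof.
move=> uv; elim: n => [|n IH].
  by rewrite muln0 /sqr_window !big_ord1; have := uv 0;
    rewrite mulr0 oppr0 add0r addrC => ->; rewrite addrC.
rewrite (_ : (2 * n.+1 = (2 * n).+2)%N); last by lia.
rewrite !(sqr_windowS _ (2 * n).+2) !(sqr_windowS _ (2 * n).+1) IH.
have e1 : (2 * n).+1 = 2 * (n%:Z + 1) - 1 :> int by lia.
have e2 : (2 * n).+2 = 2 * (n%:Z + 1) :> int by lia.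
have e3 : - (2 * (n%:Z + 1) - 1) - 1 = 2 * (- n%:Z - 1) :> int by lia.
have e4 : - (2 * (n%:Z + 1)) - 1 = 2 * (- n%:Z - 1) - 1 :> int by lia.
have := uv (n%:Z + 1); have := uv (- n%:Z - 1); rewrite e1 e2 e3 e4 => h h'.
by apply: add_two_pairs => //; rewrite addrC h addrC.
Qed.

Lemma cmv_half_window u n :
  sqr_window (cmv_half u) (2 * n).+1 = sqr_window u (2 * n).+1.
Proof.
apply: sqr_window_odd => m; rewrite cmv_half_even.
have := cmv_half_odd u (m - 1).
have -> : 2 * (m - 1) + 1 = 2 * m - 1 by lia.
have -> : 2 * (m - 1) + 2 = 2 * m by lia.
by move=> ->; rewrite szego_block_isometry.
Qed.

Lemma cmv_op_window u n :
  sqr_window (cmv_op alpha u) (2 * n) = sqr_window (cmv_half u) (2 * n).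
Proof.
by apply: sqr_window_even => m; rewrite cmv_op_even cmv_op_odd szego_block_isometry.
Qed.

Lemma le_sqr_window u (m n : nat) : (m <= n)%N -> sqr_window u m <= sqr_window u n.
Proof.
move=> mn; rewrite /sqr_window -(subnKC mn) big_split_ord /= lerDl.
by apply: sumr_ge0 => i _; rewrite addr_ge0 ?sqr_ge0.
Qed.

Lemma l2Z_sqr_window_bounded u : l2Z u -> exists t, forall n, sqr_window u n <= t.
Proof.
move=> hu; pose e := (\esum_(k in [set: int]) (normc (u k) ^+ 2)%:E)%E.
have e0 : (0 <= e)%E by apply: esum_ge0 => k _; rewrite lee_fin sqr_ge0.
have fe : e \is a fin_num by rewrite ge0_fin_numE.
exists (fine e) => n; rewrite -lee_fin fineK //; apply: esum_ge.
pose l := [seq i%:Z | i <- iota 0 n] ++ [seq - i%:Z - 1 | i <- iota 0 n].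
have ul : uniq l.
  rewrite cat_uniq !map_inj_uniq ?iota_uniq /= ?andbT => [|i j|i j]; try lia.
  by apply/hasPn => _ /mapP[i _ ->]; apply/negP => /mapP[j _]; lia.
exists [set` l]; first by split=> //; exact: finite_seq.
rewrite -fsbig_seq // big_cat /= !big_map !sumEFin -EFinD lee_fin -big_split /=.
rewrite /sqr_window -(big_mkord xpredT
  (fun i => normc (u i%:Z) ^+ 2 + normc (u (- i%:Z - 1)) ^+ 2)).
by rewrite /index_iota subn0.
Qed.
End Cmv.

(** * Resolvent vectors of the extended CMV matrix *)

(** The supremum of the sequence satisfies the same affine inequality. *)
Lemma affine_contraction_bound (R : realType) (S : nat -> R) (r c t : R) :
  0 <= r < 1 -> (forall n, S n <= r * S n.+1 + c) -> (forall n, S n <= t) ->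
  forall n, S n <= c / (1 - r).
Proof.
move=> /andP[r0 r1] hS St.
have hsup : has_sup (range S).
  by split; [exists (S 0), 0|exists t => _ [n _ <-]].
have le_sup n : S n <= sup (range S) by apply: sup_upper_bound => //; exists n.
have : sup (range S) <= r * sup (range S) + c.
  apply: ge_sup; first by case: hsup.
  by move=> _ [n _ <-]; apply: le_trans (hS n) _; rewrite lerD2r ler_wpM2l.
move=> h n; rewrite ler_pdivlMr ?subr_gt0 //.
have := ler_wpM2r (_ : 0 <= 1 - r) (le_sup n); rewrite subr_ge0 => /(_ (ltW r1)).
by move: h; move: (sup _) => M; lra.
Qed.

Section Resolvent.
Context {R : realType}.
Variable alpha : int -> R[i].
Hypothesis halpha : forall n : int, unit_disk (alpha n).
Variables (u : int -> R[i]) (w : R[i]) (c : nat).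
Hypotheses (c1 : (c <= 1)%N) (w1 : normc w < 1) (hu : l2Z u)
  (Eu : forall j, cmv_op alpha u j - w * u j = delta R c%:Z j).
Local Notation v := (cmv_half alpha u).

Let EuE j : cmv_op alpha u j = w * u j + delta R c%:Z j.
Proof. by rewrite -Eu addrC subrK. Qed.

Lemma resolvent_window_step n : sqr_window (cmv_op alpha u) n <=
  normc w ^+ 2 * sqr_window u n + (2 * normc (u c%:Z) + 1).
Proof.
set C := 2 * normc (u c%:Z) + 1.
have term j : normc (cmv_op alpha u j) ^+ 2 <=
    normc w ^+ 2 * normc (u j) ^+ 2 + C * (j == c%:Z)%:R.
  rewrite EuE /delta; case: (eqVneq j c%:Z) => [->|_]; last first.
    by rewrite mulr0n addr0 mulr0 addr0 normcM exprMn.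
  rewrite mulr1n mulr1 /C.
  have := le_normcD (w * u c%:Z) 1; rewrite normc1 normcM => h.
  have w0 := normc_ge0 w; have u0 := normc_ge0 (u c%:Z).
  have := normc_ge0 (w * u c%:Z + 1); move: (normc (_ + _)) h => p h p0.
  have : p ^+ 2 <= (normc w * normc (u c%:Z) + 1) ^+ 2 by rewrite lerXn2r // nnegrE; nra.
  have : normc w * normc (u c%:Z) <= normc (u c%:Z) by rewrite ler_piMl // ltW.
  lra.
apply: (@le_trans _ _ (\sum_(i < n) (normc w ^+ 2 *
    (normc (u i%:Z) ^+ 2 + normc (u (- i%:Z - 1)) ^+ 2) + C * (i == c :> nat)%:R))).
  apply: ler_sum => i _; apply: le_trans (lerD (term _) (term _)) _.
  rewrite (_ : (- i%:Z - 1 == c%:Z) = false); last by apply/eqP; lia.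
  by rewrite eqz_nat mulr0n mulr0 addr0 mulrDr addrAC.
rewrite big_split /= -!big_distrr /= lerD2l.
have -> : \sum_(i < n) (i == c :> nat)%:R = (c < n)%:R :> R.
  elim: n => [|n IH]; first by rewrite big_ord0.
  rewrite big_ord_recr /= IH ltnS (leq_eqVlt c n) eq_sym.
  by case: (eqVneq c n) => [->|_]; rewrite ?ltnn ?add0r ?addr0.
have C0 : 0 <= C by rewrite addr_ge0 ?mulr_ge0 ?normc_ge0.
by case: (_ < _)%N; rewrite ?mulr1 ?mulr0.
Qed.

(** The isometry of E gives S_n <= |w|^2 S_(n+1) + 2 |u_c| + 1 for the odd windows; the
shift from n to n + 1 is the price of the two interlaced pairings. *)
Lemma resolvent_window_bound n :
  sqr_window u n <= (2 * normc (u c%:Z) + 1) / (1 - normc w ^+ 2) /\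
  sqr_window v n <= (2 * normc (u c%:Z) + 1) / (1 - normc w ^+ 2).
Proof.
have [t ut] := l2Z_sqr_window_bounded hu.
have odd_bound : forall k, sqr_window u (2 * k).+1 <=
    (2 * normc (u c%:Z) + 1) / (1 - normc w ^+ 2).
  apply: (@affine_contraction_bound _ (fun k => sqr_window u (2 * k).+1) _ _ t) => //.
    by rewrite sqr_ge0 expr_lt1 ?normc_ge0.
  move=> k; rewrite -(cmv_half_window halpha).
  apply: le_trans (le_sqr_window _ (leqnSn _)) _.
  rewrite (_ : (2 * k).+2 = (2 * k.+1)%N); last by lia.
  rewrite -(cmv_op_window halpha); apply: le_trans (resolvent_window_step _) _.
  by rewrite lerD2r ler_wpM2l ?sqr_ge0 // le_sqr_window.
have nle : (n <= (2 * n).+1)%N by lia.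
split; apply: le_trans (le_sqr_window _ nle) _ => //.
by rewrite cmv_half_window.
Qed.

Variable s : R[i].
Hypotheses (s0 : s != 0) (sw : s ^+ 2 = w).

(** On the right half-line these vectors form an orbit of the Szego cocycle at the
energy s^2.  The components trade places at every step because the two factors
of E act on interlaced pairs. *)
Definition weyl_vector (k : nat) : 'cV[R[i]]_2 :=
  \col_(i < 2) (if odd k then [:: s^-1 * v k%:Z; s * u k%:Z]
                else [:: u k%:Z; v k%:Z])`_i.

Lemma weyl_vector_step k : (0 < k)%N ->
  weyl_vector k.+1 = unimodular_szego s (alpha k%:Z) *m weyl_vector k.
Proof.
move=> k0; have hk := halpha k%:Z; have r0 := disk_rho_neq0 hk.
have r2 := disk_rho_sqr hk.
have [m km] : exists m, k = (2 * m + 1)%N \/ k = (2 * m.+1)%N.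
  exists (k.-1)./2; have := odd_double_half k.-1; rewrite -mul2n.
  by case: (odd k.-1) => /=; [right|left]; lia.
case: km => km.
  have ok : odd k by rewrite km addn1 /= mul2n odd_double.
  have vk := cmv_half_odd alpha u m%:Z.
  have vk1 := cmv_half_even alpha u (m%:Z + 1).
  have i1 : 2 * m%:Z + 1 = k%:Z by lia.
  have i2 : 2 * m%:Z + 2 = k.+1%:Z by lia.
  have i3 : 2 * (m%:Z + 1) = k.+1%:Z by lia.
  have i4 : k.+1%:Z - 1 = k%:Z by lia.
  rewrite i1 i2 in vk; rewrite i3 i4 in vk1.
  apply: cV2P; rewrite mulmx2E !mxE /= ok /= vk ?vk1.
    by move: ((disk_rho _)%:C) r0 {r2 vk vk1} => t t0; field; rewrite s0.
  move: ((disk_rho _)%:C) r0 r2 {vk vk1} => t t0 r2.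
  move: (u k%:Z) (u k.+1%:Z) => u0 u1.
  rewrite (_ : t * u0 = t^-1 * (t ^+ 2 * u0)); last by field.
  by rewrite r2; field; rewrite s0.
have ok : odd k = false by rewrite km mul2n odd_double.
have d j : (1 < j)%N -> delta R c%:Z j%:Z = 0.
  by move=> j1; rewrite /delta eqz_nat gtn_eqF // (leq_ltn_trans c1).
have E0 := EuE k%:Z; have E1 := EuE k.+1%:Z.
rewrite d ?addr0 in E0; last by lia.
rewrite d ?addr0 in E1; last by lia.
have := cmv_op_even alpha u m.+1%:Z; have := cmv_op_odd alpha u m.+1%:Z.
have i1 : 2 * m.+1%:Z = k%:Z by lia.
have i2 : k%:Z + 1 = k.+1%:Z by lia.
rewrite i1 i2 E0 E1 -sw {E0 E1} => E1 E0.
have vk1 : v k.+1%:Z = ((disk_rho (alpha k%:Z))%:C)^-1 *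
    (s ^+ 2 * u k%:Z - (alpha k%:Z)^* * v k%:Z).
  by rewrite E0 addrC addKr mulKf.
have uk1 : u k.+1%:Z = s^-1 ^+ 2 *
    ((disk_rho (alpha k%:Z))%:C * v k%:Z - alpha k%:Z * v k.+1%:Z).
  by rewrite -E1 mulrA -exprMn mulVf // expr1n mul1r.
apply: cV2P; rewrite mulmx2E !mxE /= ok /= ?uk1 ?vk1.
  by move: ((disk_rho _)%:C) r0 {r2 vk1 uk1 E0 E1} => t t0; field; rewrite s0.
move: ((disk_rho _)%:C) r0 r2 {vk1 uk1 E0 E1} => t t0 r2.
move: (u k%:Z) (v k%:Z) => u0 v0.
rewrite (_ : t * v0 = t^-1 * (t ^+ 2 * v0)); last by field.
by rewrite r2; field; rewrite s0.
Qed.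

Hypotheses (s_le1 : normc s <= 1) (s_ge : 2^-1 <= normc s).

Lemma weyl_vector_sum_le n : \sum_(1 <= k < n) sqr_norm2 (weyl_vector k) <=
  8 * (2 * normc (u c%:Z) + 1) / (1 - normc w ^+ 2).
Proof.
have sp : 0 < normc s by apply: lt_le_trans s_ge; rewrite invr_gt0.
have sV : normc s^-1 ^+ 2 <= 4.
  rewrite normcV exprVn -[4]invrK lef_pV2 ?posrE ?exprn_gt0 ?invr_gt0 //.
  have h := s_ge; nra.
have s2 : normc s ^+ 2 <= 4 by have h := s_le1; have := normc_ge0 s; nra.
have term k : sqr_norm2 (weyl_vector k) <=
    4 * (normc (u k%:Z) ^+ 2 + normc (v k%:Z) ^+ 2).
  rewrite /sqr_norm2 !mxE /=; have u2 := sqr_ge0 (normc (u k%:Z)).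
  have v2 := sqr_ge0 (normc (v k%:Z)).
  case: (odd k) => /=; last by lra.
  rewrite !normcM !exprMn.
  by have := ler_wpM2r v2 sV; have := ler_wpM2r u2 s2; lra.
have [hu' hv'] := resolvent_window_bound n.
have win (y : int -> R[i]) : \sum_(1 <= k < n) normc (y k%:Z) ^+ 2 <= sqr_window y n.
  rewrite /sqr_window -(big_mkord xpredT (fun k => normc (y k%:Z) ^+ 2 + normc (y (-
    k%:Z - 1)) ^+ 2)).
  case: n {hu' hv'} => [|n]; first by rewrite !big_geq.
  rewrite [leRHS](@big_cat_nat _ _ _ 1) //= -[leLHS]add0r; apply: lerD.
    by apply: sumr_ge0 => k _; rewrite addr_ge0 ?sqr_ge0.
  by apply: ler_sum => k _; rewrite lerDl sqr_ge0.
apply: (@le_trans _ _ (\sum_(1 <= k < n) 4 * (normc (u k%:Z) ^+ 2 + normc (v k%:Z) ^+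
  2))).
  by apply: ler_sum => k _; exact: term.
rewrite -big_distrr /= big_split /= -mulrA.
have := win u; have := win v; lra.
Qed.

(** The inhomogeneous term sits in the rows 0 and 1, so the values there are
recovered from the Weyl vector at index 1 by solving these two rows. *)
Lemma resolvent_entry_le : normc (u c%:Z) <=
  4 + (4 + 12 * (disk_rho (alpha 0))^-1) * Num.sqrt (sqr_norm2 (weyl_vector 1)).
Proof.
set F := sqr_norm2 _; have F0 : 0 <= F by apply: sqr_norm2_ge0.
have sp : 0 < normc s by apply: lt_le_trans s_ge; rewrite invr_gt0.
have r0 := disk_rho_gt0 (halpha 0).
have rV1 := disk_rhoV_ge1 (halpha 0).
have FE : F = normc s^-1 ^+ 2 * normc (v 1) ^+ 2 + normc s ^+ 2 * normc (u 1) ^+ 2.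
  by rewrite /F /sqr_norm2 !mxE /= !normcM !exprMn.
set t := Num.sqrt F; have t0 : 0 <= t by rewrite sqrtr_ge0.
have tE : t ^+ 2 = F by rewrite sqr_sqrtr.
have hv1 : normc (v 1) <= t.
  rewrite -(@ler_pXn2r _ 2) ?nnegrE ?normc_ge0 // tE FE -[leLHS]addr0.
  apply: lerD; last by rewrite mulr_ge0 ?sqr_ge0.
  by rewrite ler_peMl ?sqr_ge0 // normcV exprn_ege1 // invf_ge1.
have hu1 : normc (u 1) <= 2 * t.
  rewrite -(@ler_pXn2r _ 2) ?nnegrE ?normc_ge0 ?mulr_ge0 // exprMn tE FE.
  have : 1 <= 2 ^+ 2 * normc s ^+ 2 by rewrite -exprMn exprn_ege1 //; have h := s_ge; lra.
  move=> h; have := ler_wpM2r (sqr_ge0 (normc (u 1))) h.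
  have := mulr_ge0 (sqr_ge0 (normc s^-1)) (sqr_ge0 (normc (v 1))); lra.
case: c c1 EuE => [|[|//]] _ E; last first.
  apply: (le_trans hu1);
    have : 0 <= t * (disk_rho (alpha 0))^-1 by rewrite mulr_ge0 // invr_ge0 ltW.
  lra.
have E0 := E 0; have E1 := E 1; have := cmv_op_even alpha u 0;
  have := cmv_op_odd alpha u 0.
rewrite mulr0 add0r E0 E1 /delta eqxx /= mulr1n mulr0n addr0.
set t0' := (_)%:C => e1 e0.
have hv0 : normc (v 0) <= (disk_rho (alpha 0))^-1 * (3 * t).
  rewrite (_ : v 0 = t0'^-1 * (w * u 1 + alpha 0 * v 1)); last first.
    by rewrite e1 subrK mulKf // disk_rho_neq0.
  rewrite normcM normc_disk_rhoV // ler_wpM2l ?invr_ge0 ?(ltW r0) //.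
  apply: le_trans (le_normcD _ _) _; rewrite !normcM.
  have := ler_piMl (normc_ge0 (u 1)) (ltW w1).
  have := ler_piMl (normc_ge0 (v 1)) (ltW (halpha 0 : normc _ < 1)); lra.
have hwu : normc (w * u 0) <= normc (v 0) + normc (v 1) + 1.
  rewrite (_ : w * u 0 = (alpha 0)^* * v 0 + t0' * v 1 - 1); last by rewrite -e0 addrK.
  apply: le_trans (ler_normcB _ _) _; rewrite normc1 lerD2r.
  apply: le_trans (le_normcD _ _) _; rewrite !normcM normc_conj normcR gtr0_norm //.
  have := ler_piMl (normc_ge0 (v 0)) (ltW (halpha 0 : normc _ < 1)).
  have := ler_piMl (normc_ge0 (v 1)) (disk_rho_le1 (alpha 0)); lra.
have w4 : 4^-1 <= normc w by rewrite -sw normcX; have h := s_ge; nra.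
have := ler_wpM2r (normc_ge0 (u 0)) w4; rewrite -normcM; lra.
Qed.
End Resolvent.

(** * Resolvent entries next to an energy with bounded traces *)

Section ResolventGrowth.
Context {R : realType}.
Variables (a b : R[i]) (alpha : int -> R[i]).
Hypotheses (ha : unit_disk a) (hb : unit_disk b)
  (halpha : forall n : int, unit_disk (alpha n))
  (hfib : is_fibonacci_sequence a b (fun n : nat => alpha n%:Z)).
Local Notation K := (szego_size a b).
Local Notation B := (szego_trace_bound a b).

(** Cost of passing from the Weyl vector at index 1 to the entries of the resolvent
vector in the block of the inhomogeneous term. *)
Definition edge_factor : R := 4 + 12 * (disk_rho a)^-1.
Local Notation E := edge_factor.

Lemma edge_factor_ge0 : 0 <= E.
Proof. by rewrite addr_ge0 // mulr_ge0 // invr_ge0 ltW // disk_rho_gt0. Qed.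

(** Let y be the norm of the Weyl vector at index 1.  The growth of the orbit gives
l^n y^2 at most a multiple of the squared norm of u, the isometry bounds this
norm by a multiple of (1 + |u_c|) / e, and |u_c| is at most affine in y. *)
Lemma resolvent_entry_bound (s : R[i]) (e : R) (n c : nat) (u : int -> R[i]) :
  normc s = 1 -> bounded_trace_set alpha (s ^+ 2) -> 0 < e <= 2^-1 ->
  (2 * B + 2) ^+ (4 * n) * (10 * K ^+ 2 * e) <= 1 ->
  (c <= 1)%N -> l2Z u ->
  (forall j, cmv_op alpha u j - ((1 - e)%:C * s) ^+ 2 * u j = delta R c%:Z j) ->
  normc (u c%:Z) <=
    4 + 2 * E + 2 * E * (72 + 16 * E) / (e * gordon_ratio (B + 1) ^+ n).
Proof.
move=> s1 hs he small c1 hu Eu; have /andP[e0 e1] := he.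
set t := (1 - e)%:C * s; set w := t ^+ 2.
have e2 : 0 <= e * (2^-1 - e) by rewrite mulr_ge0 ?subr_ge0 // ltW.
have tn : normc t = 1 - e by rewrite /t normcM s1 mulr1 normcR ger0_norm; lra.
have t0 : t != 0.
  by apply/eqP => h; move: tn; rewrite h normc0; lra.
have wn : normc w = (1 - e) ^+ 2 by rewrite /w normcX tn.
have w1 : normc w < 1 by rewrite wn; nra.
have w2 : e <= 1 - normc w ^+ 2 by rewrite wn; nra.
have t_le1 : normc t <= 1 by rewrite tn; lra.
have t_ge : 2^-1 <= normc t by rewrite tn; lra.
set X := weyl_vector alpha u t.
set y := Num.sqrt (sqr_norm2 (X 1)).
have y0 : 0 <= y by rewrite sqrtr_ge0.
have yE : y ^+ 2 = sqr_norm2 (X 1) by rewrite sqr_sqrtr ?sqr_norm2_ge0.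
have a0 : alpha 0 = a := fib_sequence0 hfib.
have u_le : normc (u c%:Z) <= 4 + E * y.
  by have := resolvent_entry_le halpha c1 w1 Eu (erefl w) t_le1 t_ge; rewrite a0.
have E0 := edge_factor_ge0.
have l1 := gordon_ratio_gt1 (B + 1).
set l := gordon_ratio (B + 1) in l1 *.
have ln0 : 0 < l ^+ n by rewrite exprn_gt0 // (lt_trans ltr01).
have growth : l ^+ n * y ^+ 2 <= \sum_(1 <= k < fib_length (4 * n).+1) sqr_norm2 (X k).
  rewrite yE; apply: (fib_orbit_growth (g := unimodular_szego t) hfib) => //.
  - by move=> k; exact: szego_fib_det.
  - by move=> k k0; exact: (weyl_vector_step halpha c1 w1 Eu t0 (erefl w) k0).
  - by move=> k kn; exact: (szego_trace_near ha hb hfib s1 hs he small kn).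
have decay := weyl_vector_sum_le halpha c1 w1 hu Eu t_le1 t_ge (fib_length (4 * n).+1).
have u0 := normc_ge0 (u c%:Z).
(* Growth against decay gives a quadratic inequality for y. *)
have quad : e * l ^+ n * y ^+ 2 <= (72 + 16 * E) * (1 + y).
  apply: (@le_trans _ _ (8 * (2 * normc (u c%:Z) + 1))); last first.
    by have := mulr_ge0 E0 y0; lra.
  rewrite -mulrA; apply: (@le_trans _ _ (e * (8 * (2 * normc (u c%:Z) + 1) / (1 - normc
    w ^+ 2)))).
    by rewrite ler_wpM2l ?(ltW e0) // (le_trans growth decay).
  rewrite mulrA ler_pdivrMr ?(lt_le_trans e0) // mulrC ler_wpM2l //.
  by rewrite mulr_ge0 // addr_ge0 // mulr_ge0.
have d0 : 0 < e * l ^+ n by rewrite mulr_gt0.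
set A := (72 + 16 * E) / (e * l ^+ n).
have A0 : 0 <= A by rewrite divr_ge0 ?(ltW d0) // addr_ge0 // mulr_ge0.
have quadA : y ^+ 2 <= A * (1 + y).
  by rewrite /A mulrAC ler_pdivlMr // mulrC.
have yA : y <= 2 + 2 * A.
  rewrite leNgt; apply/negP => h.
  have : (2 + 2 * A) * y <= y ^+ 2 by rewrite expr2 ler_wpM2r // ltW.
  have : A <= A * y by rewrite ler_peMr //; lra.
  lra.
have := ler_wpM2l E0 yA; rewrite -mulrA -/A; lra.
Qed.
End ResolventGrowth.

(** * Borel sets and arcs of the plane *)

Section BorelPlane.
Context {R : realType}.
Local Notation C := (R[i]).

Lemma complex_gt0P (e : C) : 0 < e -> exists2 d : R, 0 < d & e = d%:C.
Proof.
by case: e => d d'; rewrite ltcE /= => /andP[/eqP -> d0]; exists d.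
Qed.

Lemma ltc_normc (x : C) (d : R) : (`|x| < d%:C) = (normc x < d).
Proof. by rewrite ltcE /= eqxx. Qed.

(** The radius of a ball in the plane is itself a complex number; here real radii
suffice. *)
Lemma open_normcP (A : set (C^o)) :
  (forall x : C, A x -> exists2 d : R, 0 < d & forall y, normc (y - x) < d -> A y) ->
  open A.
Proof.
move=> hA; rewrite openE => x /hA[d d0 hd]; apply/nbhs_ballP.
exists d%:C => /=; first by rewrite ltcR.
move=> y; rewrite -ball_normE /= ltc_normc => xy; apply: hd.
by rewrite -normcN opprB.
Qed.

Lemma measurable_openC (A : set (C^o)) : open A -> measurable (A : set (borelC R)).
Proof. by move=> oA; apply: sub_sigma_algebra. Qed.

Lemma measurable_closedC (A : set (C^o)) : closed A -> measurable (A : set (borelC R)).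
Proof. by move=> /closed_openC/measurable_openC/measurableC; rewrite setCK. Qed.

Lemma measurable_unit_circle : measurable (@unit_circle R : set (borelC R)).
Proof.
suff : open (~` @unit_circle R : set C^o).
  by move=> /measurable_openC/measurableC; rewrite setCK.
apply: open_normcP => x /eqP x1.
exists (`|normc x - 1|); first by rewrite normr_gt0 subr_eq0.
move=> y xy y1; move: xy; rewrite -y1 ltNge => /negP; apply.
have h1 := le_normcD (y - x) x; have h2 := ler_normcB y (y - x).
rewrite subrK in h1; rewrite opprB addrC subrK in h2.
by rewrite ler_norml; apply/andP; split; lra.
Qed.

(** The preimage of ]p, r[ is cut out of D by the open set of points at which the
Lipschitz estimate from some point of D already forces the value into ]p, r[. *)
Lemma lipschitz_measurable (D : set (borelC R)) (f : borelC R -> R) (l : R) :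
  measurable D -> 0 < l ->
  (forall x y : C, D x -> D y -> `|f x - f y| <= l * normc (x - y)) ->
  measurable_fun D f.
Proof.
move=> mD l0 fl; apply: (measurability _ (measurable_realfun.RGenOpens.measurableE R)).
move=> _ [_ [p [r ->]] <-].
pose U : set C^o := [set x | exists x0 : C, [/\ D x0, p < f x0 - l * normc (x - x0) &
  f x0 + l * normc (x - x0) < r]].
rewrite (_ : D `&` _ = D `&` (U : set (borelC R))); last first.
  apply/seteqP; split=> x [Dx] /=.
    rewrite in_itv /= => /andP[px xr]; split=> //; exists x.
    by rewrite subrr normc0 mulr0 subr0 addr0.
  move=> [x0 [Dx0 h1 h2]]; split=> //; rewrite /= in_itv /=.
  by have := fl _ _ Dx Dx0; rewrite ler_norml => /andP[]; lra.
apply: measurableI => //; apply: measurable_openC;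
  apply: open_normcP => x [x0 [Dx0 h1 h2]].
(* eta is the room that the two strict inequalities at x leave. *)
pose eta := Num.min (f x0 - l * normc (x - x0) - p) (r - (f x0 + l * normc (x - x0))).
have eta0 : 0 < eta by rewrite lt_min; apply/andP; split; lra.
exists (eta / l); first by rewrite divr_gt0.
move=> y; rewrite ltr_pdivlMr // => hy; exists x0.
have tri : normc (y - x0) <= normc (y - x) + normc (x - x0).
  by have := le_normcD (y - x) (x - x0); rewrite addrA subrK.
have := ler_wpM2l (ltW l0) tri.
have : normc (y - x) * l < eta by [].
rewrite lt_min => /andP[e1 e2] e3; split=> //; lra.
Qed.

Lemma lipschitz_of_derive_le1 (f df : R -> R) : (forall x : R, is_derive x (1 : R) f
  (df x)) ->
  (forall x, `|df x| <= 1) -> forall x y, `|f x - f y| <= `|x - y|.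
Proof.
move=> fd d1 x y; wlog xy : x y / x <= y.
  by move=> h; have [/h//|/ltW/h] := leP x y; rewrite distrC [leRHS]distrC.
have cf : {within `[x, y], continuous f}.
  apply: continuous_subspaceT => z; apply: differentiable_continuous.
  by apply/derivable1_diffP; have [] := fd z.
have [c _ e] := MVT_segment xy (fun z _ => fd z) cf.
by rewrite distrC e normrM [leRHS]distrC ler_piMl.
Qed.

Lemma lipschitz_expi (x y : R) : normc (expi x - expi y) ^+ 2 <= 2 * `|x - y| ^+ 2.
Proof.
rewrite sqr_normcE /=.
have hc := @lipschitz_of_derive_le1 cos (fun x => - sin x) _ _ x y.
have hs := @lipschitz_of_derive_le1 sin cos _ _ x y.
have {}hc : `|cos x - cos y| <= `|x - y|.
  by apply: hc => z; rewrite normrN sin_max.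
have {}hs : `|sin x - sin y| <= `|x - y|.
  by apply: hs => z; exact: cos_max.
have sq (t : R) : `|t| <= `|x - y| -> t ^+ 2 <= `|x - y| ^+ 2.
  by move=> h; rewrite -real_normK ?num_real // lerXn2r ?nnegrE.
have := sq _ hc; have := sq _ hs; lra.
Qed.

Lemma normc_expi (x : R) : normc (expi x) = 1.
Proof. by rewrite /normc /= cos2Dsin2 sqrtr1. Qed.

(** An arc is the image of a segment under a continuous map, hence compact. *)
Lemma measurable_arc (Theta eps : R) : measurable (Defs.arc Theta eps).
Proof.
apply: measurable_closedC; apply: compact_closed; first exact: norm_hausdorff.
have -> : Defs.arc Theta eps = (@expi R : R -> C^o) @` `[Theta - eps, Theta + eps].
  apply/seteqP; split=> _ [t ht <-]; exists t => //; move: ht;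
    by rewrite /= in_itv /= ler_norml => /andP[h1 h2]; apply/andP; split; lra.
apply: continuous_compact; last exact: segment_compact.
apply: continuous_subspaceT => x A /nbhs_ballP[e /= /complex_gt0P[d d0 ->] hA].
apply/nbhs_ballP; exists (d / 2) => /=; first by rewrite divr_gt0.
move=> y; rewrite /ball /= => xy; apply: hA; rewrite -ball_normE /= ltc_normc.
rewrite -(@ltr_pXn2r _ 2) ?nnegrE ?normc_ge0 ?(ltW d0) //.
apply: le_lt_trans (lipschitz_expi _ _) _.
have : `|x - y| ^+ 2 < (d / 2) ^+ 2 by rewrite ltr_pXn2r ?nnegrE ?divr_ge0 ?(ltW d0).
have := sqr_ge0 d; lra.
Qed.

End BorelPlane.

(** * Poisson integrals and arcs *)

Section Poisson.
Context {R : realType}.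
Local Notation C := (R[i]).
Local Notation circle := (@unit_circle R : set (borelC R)).
Variables (mu : {finite_measure set (borelC R) -> \bar R}) (w : C).
Hypothesis w1 : normc w < 1.

Lemma normc_circle_sub (x : C) : normc x = 1 -> 1 - normc w <= normc (x - w).
Proof. by move=> x1; have := lerB_normcD x (- w); rewrite normcN x1. Qed.

Lemma circle_sub_neq0 (x : C) : normc x = 1 -> x - w != 0.
Proof.
move=> /normc_circle_sub h; apply/eqP => e; move: h w1; rewrite e normc0; lra.
Qed.

Lemma cauchy_kernel_integrable (k : C) :
  mu.-integrable circle (EFin \o (fun x => complex.Re (k * ((x : C) - w)^-1))).
Proof.
have d0 : 0 < 1 - normc w by rewrite subr_gt0.
have ReB (p r : C) : `|complex.Re p - complex.Re r| <= normc (p - r).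
  have ReE (y z : C) : complex.Re (y - z) = complex.Re y - complex.Re z.
    by case: y z => [? ?] [? ?].
  have := le_Re_normc (r - p); have := le_Re_normc (p - r).
  rewrite !ReE -(normcN (r - p)) opprB => h1 h2.
  by rewrite ler_norml; apply/andP; split; lra.
have inv_le (x : C) : normc x = 1 -> normc (x - w)^-1 <= (1 - normc w)^-1.
  move=> x1; rewrite normcV lef_pV2 ?posrE ?normc_circle_sub //.
  exact: lt_le_trans d0 (normc_circle_sub x1).
apply: measurable_bounded_integrable.
- exact: measurable_unit_circle.
- by rewrite ltey_eq fin_num_measure //; exact: measurable_unit_circle.
- apply: (@lipschitz_measurable _ _ _ ((normc k + 1) * (1 - normc w)^-1 ^+ 2)).
  + exact: measurable_unit_circle.
  + by rewrite mulr_gt0 ?exprn_gt0 ?invr_gt0 // ltr_wpDl ?normc_ge0.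
  move=> x y x1 y1; apply: le_trans (ReB _ _) _.
  have x0 := circle_sub_neq0 x1; have y0 := circle_sub_neq0 y1.
  rewrite (_ : k * (x - w)^-1 - k * (y - w)^-1 =
    k * ((x - w)^-1 * (y - w)^-1) * (y - x)); last by field; rewrite x0 y0.
  rewrite !normcM -(normcN (y - x)) opprB ler_wpM2r ?normc_ge0 // expr2.
  apply: ler_pM; rewrite ?mulr_ge0 ?normc_ge0 ?lerDl //.
  by apply: ler_pM; rewrite ?normc_ge0 ?inv_le.
- exists (normc k * (1 - normc w)^-1); split; first exact: num_real.
  move=> t /ltW kt x x1 /=; apply: le_trans kt.
  have := ReB (k * (x - w)^-1) 0; rewrite /= !subr0 => h; apply: le_trans h _.
  by rewrite normcM ler_wpM2l ?normc_ge0 ?inv_le.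
Qed.

Lemma cauchy_kernel_integral (k : C) :
  Rintegral mu circle (fun x => complex.Re (k * ((x : C) - w)^-1)) =
  complex.Re (k * integralC mu circle (fun x => ((x : C) - w)^-1)).
Proof.
pose h (x : borelC R) : C := ((x : C) - w)^-1.
have iRe : mu.-integrable circle (EFin \o (fun x => complex.Re (h x))).
  have := cauchy_kernel_integrable 1.
  by under [X in EFin \o X]eq_fun do rewrite mul1r.
have iIm : mu.-integrable circle (EFin \o (fun x => complex.Im (h x))).
  have := cauchy_kernel_integrable (- 'i%C).
  rewrite (_ : (fun x => _) = (fun x => complex.Im (h x))) //; apply/funext => x.
  by rewrite -/(h x); case: (h x) => p r /=; ring.
have mC := @measurable_unit_circle R.
case: k => p r; rewrite /integralC.
rewrite (_ : (fun x => _) = (fun x => p * complex.Re (h x) - r * complex.Im (h x)));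
  last first.
  by apply/funext => x; rewrite -/(h x); case: (h x).
rewrite (@RintegralB _ _ _ mu _ (fun x => p * complex.Re (h x))
  (fun x => r * complex.Im (h x)) mC (integrableZl mC p iRe) (integrableZl mC r iIm)).
by rewrite !RintegralZl.
Qed.

(** The Poisson kernel at w, written through the Cauchy kernel so that its integral is
read off from the Borel transform. *)
Definition poisson (x : C) : R := 1 + complex.Re (2 * w * (x - w)^-1).

Lemma poissonE (x : C) : normc x = 1 ->
  poisson x = (1 - normc w ^+ 2) / normc (x - w) ^+ 2.
Proof.
move=> x1; have n0 : normc (x - w) ^+ 2 != 0.
  rewrite expf_neq0 // gt_eqF // (lt_le_trans _ (normc_circle_sub x1)) //.
  by rewrite subr_gt0.
have : normc x ^+ 2 = 1 by rewrite x1 expr1n.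
rewrite -[in normc x](subrK w x) /poisson -mulrA mulrDl mul1r.
move: (x - w) n0 => y; rewrite !sqr_normcE; case: (w) => p r; case: y => p' r' /=.
move=> n0 e; rewrite (_ : 1 - (p ^+ 2 + r ^+ 2) =
  p' ^+ 2 + r' ^+ 2 + 2 * (p * p' + r * r')); last by lra.
by field.
Qed.

Lemma poisson_integral :
  mu.-integrable circle (EFin \o (fun x => poisson (x : C))) /\
  Rintegral mu circle (fun x => poisson (x : C)) = fine (mu circle) +
    complex.Re (2 * w * integralC mu circle (fun x => ((x : C) - w)^-1)).
Proof.
have mC := @measurable_unit_circle R.
have i1 := finite_measure_integrable_cst mu 1 mC.
have i2 := cauchy_kernel_integrable (2 * w).
split; first exact: (integrableD mC i1 i2).
rewrite -cauchy_kernel_integral -[fine _]mul1r -Rintegral_cst // -RintegralD //.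
Qed.

(** On the arc the Poisson kernel at w is at least 1 / (16 e), because w lies within
2 e of the centre and 1 - |w|^2 >= e. *)
Lemma arc_measure_le (Theta e : R) : 0 < e <= 2^-1 -> normc w = (1 - e) ^+ 2 ->
  normc (expi Theta - w) <= 2 * e ->
  (mu (Defs.arc Theta e) <= (16 * e * (fine (mu circle) +
     2 * normc (integralC mu circle (fun x => ((x : C) - w)^-1))))%:E)%E.
Proof.
move=> /andP[e0 e1] we zw; have mC := @measurable_unit_circle R.
have mA := measurable_arc Theta e.
have e2 : 0 <= e * (2^-1 - e) by rewrite mulr_ge0 ?subr_ge0 // ltW.
have w2 : e <= 1 - normc w ^+ 2 by rewrite we; nra.
have arcC : Defs.arc Theta e `<=` circle by move=> _ [t _ <-]; exact: normc_expi.
have P_arc x : Defs.arc Theta e x -> (16 * e)^-1 <= poisson x.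
  move=> Ax; rewrite poissonE; last exact: arcC.
  have nxw : 0 < normc (x - w).
    by apply: lt_le_trans (normc_circle_sub (arcC _ Ax)); rewrite subr_gt0.
  have xw : normc (x - w) <= 4 * e.
    case: Ax => t /= te <-.
    have := le_normcD (expi t - expi Theta) (expi Theta - w); rewrite addrA subrK.
    have : normc (expi t - expi Theta) <= 2 * e.
      rewrite -(@ler_pXn2r _ 2) ?nnegrE ?normc_ge0 ?mulr_ge0 ?(ltW e0) //.
      apply: le_trans (lipschitz_expi _ _) _.
      have : `|t - Theta| ^+ 2 <= e ^+ 2 by rewrite lerXn2r ?nnegrE ?(ltW e0).
      have := sqr_ge0 e; lra.
    lra.
  rewrite ler_pdivlMr ?exprn_gt0 // mulrC ler_pdivrMr ?mulr_gt0 //.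
  apply: (@le_trans _ _ ((4 * e) ^+ 2));
    first by rewrite lerXn2r ?nnegrE ?normc_ge0 ?mulr_ge0 ?(ltW e0).
  have : e * e <= e * (1 - normc w ^+ 2) by rewrite ler_wpM2l // ltW.
  lra.
have [iP intP] := poisson_integral.
have P_ge0 x : circle x -> 0 <= poisson x.
  move=> x1; rewrite poissonE // divr_ge0 ?sqr_ge0 // (le_trans (ltW e0)) //.
have mP := measurable_int _ iP.
have step : (((16 * e)^-1)%:E * mu (Defs.arc Theta e) <=
    \int[mu]_(x in circle) (poisson (x : C))%:E)%E.
  rewrite -integral_cst //.
  apply: (@le_trans _ _ (\int[mu]_(x in Defs.arc Theta e) (poisson (x : C))%:E)%E).
    apply: ge0_le_integral => //.
    - by move=> x _; rewrite lee_fin invr_ge0 mulr_ge0 // ltW.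
    - exact: measurable_funS arcC mP.
  apply: ge0_subset_integral => //.
have intE : (\int[mu]_(x in circle) (poisson (x : C))%:E)%E =
    (Rintegral mu circle (fun x => poisson (x : C)))%:E.
  by rewrite /Rintegral fineK // integrable_fin_num.
have e16 : 0 < 16 * e by rewrite mulr_gt0.
move: step; rewrite intE intP -(@lee_pmul2l _ (16 * e)%:E) ?lte_fin // muleA -EFinM.
rewrite divff ?gt_eqF // mul1e => h; apply: le_trans h _.
rewrite -EFinM lee_fin ler_wpM2l ?(ltW e16) // lerD2l.
apply: le_trans (le_Re_normc _) _; rewrite -mulrA normcM.
rewrite (_ : normc (2 : C) = 2); last by rewrite normcMn normc1.
by rewrite ler_wpM2l // normcM ler_piMl ?normc_ge0 // ltW.
Qed.
End Poisson.

(** * Power laws and Hoelder continuity *)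

Lemma bernoulli_geometric (R : realDomainType) (d : R) (n : nat) : 1 <= d ->
  1 + n%:R * (d - 1) <= d ^+ n.
Proof.
move=> d1; elim: n => [|n IH]; first by rewrite mul0r addr0 expr0.
rewrite exprS -natr1; apply: (le_trans _ (ler_wpM2l (le_trans ler01 d1) IH)).
have : 0 <= n%:R * (d - 1) * (d - 1) by rewrite !mulr_ge0 // subr_ge0.
lra.
Qed.

Section SpectralMeasure.
Context {R : realType}.
Local Notation C := (R[i]).

Lemma circle_sqrt (z : C) : normc z = 1 -> exists2 s : C, normc s = 1 & s ^+ 2 = z.
Proof.
move=> z1; exists (sqrtC z); last exact: sqrtCK.
have : normc (sqrtC z) ^+ 2 = 1 by rewrite -normcX sqrtCK.
by move=> /eqP; rewrite sqrf_eq1 => /orP[/eqP//|/eqP h]; have := normc_ge0 (sqrtC z);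
  rewrite h; lra.
Qed.

Lemma l2_inner_delta (f : int -> C) (c : nat) :
  l2_inner (delta R c%:Z) f = f c%:Z.
Proof.
rewrite /l2_inner; apply: (@cvg_lim C^o); first exact: norm_hausdorff.
apply: cvg_near_cst; exists c => // N /= cN.
have lt : (N + c < (2 * N).+1)%N by lia.
have Nc : (N + c)%N%:Z - N%:Z = c%:Z by lia.
rewrite (bigD1 (Ordinal lt)) //= Nc /delta eqxx mulr1n.
rewrite [X in _ + X]big1 ?addr0; first by rewrite rmorph1 mul1r.
move=> i /eqP ic; rewrite (_ : (i%:Z - N%:Z == c%:Z) = false) ?mulr0n ?rmorph0 ?mul0r //.
by apply/eqP => h; apply: ic; apply: val_inj => /=; lia.
Qed.

Variables (a b : C) (alpha : int -> C).
Hypotheses (ha : unit_disk a) (hb : unit_disk b)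
  (halpha : forall n : int, unit_disk (alpha n))
  (hfib : is_fibonacci_sequence a b (fun n : nat => alpha n%:Z)).
Local Notation K := (szego_size a b).
Local Notation B := (szego_trace_bound a b).
Local Notation E := (edge_factor a).
Local Notation l := (gordon_ratio (B + 1)).
Local Notation D4 := ((2 * B + 2) ^+ 4).
Local Notation kappa := (10 * K ^+ 2).

(** The Borel transform at w of the spectral measure of delta_c is the entry at c of the
resolvent vector. *)
Lemma spectral_arc_bound (mu : {finite_measure set (borelC R) -> \bar R})
    (c n : nat) (Theta e : R) :
  (c <= 1)%N -> is_spectral_measure (cmv_op alpha) (delta R c%:Z) mu ->
  bounded_trace_set alpha (expi Theta) -> 0 < e <= 2^-1 ->
  D4 ^+ n * (kappa * e) <= 1 ->
  (mu (Defs.arc Theta e) <= (16 * e * (fine (mu (@unit_circle R)) +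
    2 * (4 + 2 * E + 2 * E * (72 + 16 * E) / (e * l ^+ n))))%:E)%E.
Proof.
move=> c1 [_ hmu] hT he small; have /andP[e0 e1] := he.
have [s s1 sz] := circle_sqrt (normc_expi Theta).
pose w := ((1 - e)%:C * s) ^+ 2.
have e2 : 0 <= e * (2^-1 - e) by rewrite mulr_ge0 ?subr_ge0 // ltW.
have wn : normc w = (1 - e) ^+ 2.
  by rewrite /w normcX normcM s1 mulr1 normcR ger0_norm //; lra.
have w1 : normc w < 1 by rewrite wn; nra.
have zw : normc (expi Theta - w) <= 2 * e.
  have -> : expi Theta - w = (1 - (1 - e) ^+ 2)%:C * expi Theta.
    have -> : (1 - (1 - e) ^+ 2)%:C = 1 - (1 - e)%:C ^+ 2 :> C.
      by rewrite rmorphB rmorph1 (rmorphXn (real_complex R)).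
    by rewrite /w -sz exprMn; ring.
  by rewrite normcM normc_expi mulr1 normcR ger0_norm; nra.
have hw : ~ unit_circle w by move=> h; move: w1; rewrite h ltxx.
apply: le_trans (arc_measure_le mu w1 he wn zw) _.
rewrite lee_fin ler_wpM2l ?mulr_ge0 ?(ltW e0) // lerD2l ler_wpM2l //.
rewrite -(hmu w hw) l2_inner_delta.
have E0 := edge_factor_ge0 ha.
have l0 : 0 < l ^+ n by rewrite exprn_gt0 // (lt_trans ltr01) // gordon_ratio_gt1.
rewrite /resolvent; set S := [set psi | _].
(* When no vector solves the resolvent equation, the value 0 trivially obeys
   the bound. *)
case: (xgetP (fun=> 0) S) => [psi _ [hpsi Epsi]|_]; last first.
  have F0 : 0 <= 2 * E * (72 + 16 * E) by rewrite mulr_ge0 ?mulr_ge0 // addr_ge0 //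
    mulr_ge0.
  have := divr_ge0 F0 (ltW (mulr_gt0 e0 l0)); rewrite normc0; lra.
apply: (resolvent_entry_bound ha hb halpha hfib s1 _ he _ c1 hpsi Epsi).
  by rewrite sz.
by rewrite exprM.
Qed.

(** Per four levels a perturbation grows by at most (2 B + 2)^4 while the sum of squares
grows by at least the factor l; comparing the two rates gives the exponent. *)
Definition perturbation_exponent : R := geometric_exponent D4 l.

Lemma trace_growth_gt1 : 1 < D4.
Proof.
have B0 := szego_trace_bound_ge0 a b.
by apply: exprn_egt1 => //; lra.
Qed.

Lemma kappa_ge10 : 10 <= kappa.
Proof. by have := szego_size_ge1 ha hb => K1; nra. Qed.

(** For the last controlled level n, l^(-n) is at most a constant times
e^(2 h), with h the exponent comparing the two rates. *)
Lemma spectral_arc_holder (mu : {finite_measure set (borelC R) -> \bar R})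
    (c : nat) (beta : R) :
  (c <= 1)%N -> is_spectral_measure (cmv_op alpha) (delta R c%:Z) mu ->
  beta <= 1 -> beta <= 2 * perturbation_exponent ->
  exists2 A : R, 0 < A & forall Theta e : R, bounded_trace_set alpha (expi Theta) ->
    0 < e < kappa^-1 -> (mu (Defs.arc Theta e) <= (A * e `^ beta)%:E)%E.
Proof.
move=> c1 hmu b1 b2.
have D1 := trace_growth_gt1; have k10 := kappa_ge10.
have E0 := edge_factor_ge0 ha; have l1 := gordon_ratio_gt1 (B + 1).
set m := fine (mu (@unit_circle R)).
have m0 : 0 <= m by apply: fine_ge0.
set g := perturbation_exponent in b2.
have kp : 0 < kappa by lra.
have kg : 0 < (kappa `^ g) ^+ 2 by rewrite exprn_gt0 // powR_gt0.
have l0 : 0 < l by lra.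
set A1 := 64 * E * (72 + 16 * E) * (l * (kappa `^ g) ^+ 2).
have F0 : 0 <= 64 * E * (72 + 16 * E).
  by rewrite mulr_ge0 ?mulr_ge0 // addr_ge0 // mulr_ge0.
have A10 : 0 <= A1 := mulr_ge0 F0 (ltW (mulr_gt0 l0 kg)).
exists (16 * (m + 8 + 4 * E) + A1).
  by rewrite ltr_wpDr // mulr_gt0 // ltr_wpDr ?mulr_ge0 // ltr_wpDl.
move=> Theta e hT /andP[e0 ek].
have e2 : 0 < e <= 2^-1.
  rewrite e0 (le_trans (ltW ek)) // lef_pV2 ?posrE //; lra.
have ke1 : kappa * e < 1 by rewrite -ltr_pdivlMl // mulr1.
have ke0 : 0 < kappa * e by rewrite mulr_gt0.
(* n is the last level up to which the traces are controlled at distance e from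
   the circle. *)
have [n small big] : exists2 n, D4 ^+ n * (kappa * e) <= 1 & 1 < D4 ^+ n.+1 * (kappa * e).
  have ex : exists n, 1 < D4 ^+ n.+1 * (kappa * e).
    have [N hN] : exists N : nat, (kappa * e)^-1 / (D4 - 1) < N%:R.
      exists (Num.bound ((kappa * e)^-1 / (D4 - 1))); apply: archi_boundP.
      by rewrite divr_ge0 ?invr_ge0 ?(ltW ke0) // subr_ge0 ltW.
    exists N; rewrite -ltr_pdivrMr // mul1r.
    rewrite ltr_pdivrMr ?subr_gt0 // in hN; apply: (lt_le_trans hN).
    have := bernoulli_geometric N.+1 (ltW D1); rewrite -natr1; move: D1;
      move: (D4) (N%:R) => d j; lra.
  case: (ex_minnP ex) => -[|n] hn hmin; first by exists 0 => //; rewrite expr0 mul1r ltW.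
  exists n.+1 => //; rewrite leNgt; apply/negP => /hmin; by rewrite ltnn.
apply: le_trans (spectral_arc_bound c1 hmu hT e2 small) _.
rewrite lee_fin -/m.
have ln0 : 0 < l ^+ n by rewrite exprn_gt0.
have g0 : 0 <= g by apply/ltW/geometric_exponent_gt0.
have e_le1 : 0 < e <= 1 by rewrite e0; have /andP[_] := e2; lra.
have hlin : e <= e `^ beta by rewrite -[leLHS]powRr1 ?(ltW e0) //; apply: ger_powR.
have hg : (e `^ g) ^+ 2 <= e `^ beta.
  by rewrite -powR_mulrn ?powR_ge0 // -powRrM mulrC; apply: ger_powR.
have inv_l : (l ^+ n)^-1 <= l * (kappa `^ g) ^+ 2 * (e `^ g) ^+ 2.
  rewrite -mulrA -exprMn -powRM ?(ltW e0) ?(ltW kp) //.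
  have D4n : 0 <= D4 ^+ n.+1 := exprn_ge0 _ (ltW (lt_trans ltr01 D1)).
  have h : ((kappa * e) `^ g)^-1 <= (D4 ^+ n.+1) `^ g.
    rewrite -[X in X <= _]mul1r ler_pdivrMr ?powR_gt0 //.
    rewrite -powRM ?(ltW ke0) //.
    apply: (@le_trans _ _ (1 `^ g)); first by rewrite powR1.
    by apply: ge0_ler_powR; rewrite ?nnegrE ?ler01 ?(ltW big) // mulr_ge0 // ltW.
  have h2 : (((kappa * e) `^ g) ^+ 2)^-1 <= l ^+ n.+1.
    rewrite -(sqr_powR_geometric n.+1 D1 l0) -/perturbation_exponent -/g -exprVn.
    by rewrite lerXn2r ?nnegrE ?invr_ge0 ?powR_ge0.
  move: h2; rewrite -[leLHS]mul1r ler_pdivrMr ?exprn_gt0 ?powR_gt0 // exprS => h2.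
  by rewrite -[leLHS]mul1r ler_pdivrMr // mulrAC.
have split_E : 16 * e * (m + 2 * (4 + 2 * E + 2 * E * (72 + 16 * E) / (e * l ^+ n))) =
    16 * (m + 8 + 4 * E) * e + 64 * E * (72 + 16 * E) * (l ^+ n)^-1.
  by move: (E) (l ^+ n) ln0 => x y y0; field; rewrite !gt_eqF.
rewrite split_E [leRHS]mulrDl; apply: lerD.
  by rewrite ler_wpM2l // mulr_ge0 // !addr_ge0 // mulr_ge0.
rewrite /A1 -[leRHS]mulrA ler_wpM2l //.
by apply: le_trans inv_l _; rewrite ler_wpM2l // ltW // mulr_gt0.
Qed.
End SpectralMeasure.

Theorem corollary1 (R : realType) (a b : R[i]) (alpha : int -> R[i])
    (ha : unit_disk a) (hb : unit_disk b)
    (halpha : forall n : int, unit_disk (alpha n))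
    (hfib : is_fibonacci_sequence a b (fun n : nat => alpha n%:Z)) :
  exists gamma1 gamma2 C1 C2 L0 : R,
    [/\ 0 < gamma1, 0 < gamma2, 0 < C1, 0 < C2 & 0 < L0] /\
    (forall z : R[i], bounded_trace_set alpha z ->
      forall eta : nat -> R[i], transfer_solution alpha z eta ->
        normalized eta ->
        forall L : R, L0 <= L ->
          C1 * L `^ gamma1 <= norm_at eta L <= C2 * L `^ gamma2) /\
    (forall mu0 mu1 : {finite_measure set (borelC R) -> \bar R},
      is_spectral_measure (cmv_op alpha) (delta R 0) mu0 ->
      is_spectral_measure (cmv_op alpha) (delta R 1) mu1 ->
      uniformly_holder (2 * gamma1 / (gamma1 + gamma2))
        (bounded_trace_set alpha) (measure_add mu0 mu1)).
Proof.
set l1 := gordon_ratio (szego_trace_bound a b).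
have l1_gt1 : 1 < l1 := gordon_ratio_gt1 _.
set g1 := geometric_exponent 16 l1.
have g1_gt0 : 0 < g1 by apply: geometric_exponent_gt0 => //; lra.
set lu := solution_upper_ratio a b.
have lu_gt1 : 1 < lu := solution_upper_ratio_gt1 a b.
set Au := solution_upper_const a b.
have Au_gt0 : 0 < Au := solution_upper_const_gt0 ha hb.
set gu := geometric_exponent 2 lu.
have gu_gt0 : 0 < gu by apply: geometric_exponent_gt0 => //; lra.
set h := perturbation_exponent a b.
have h_gt0 : 0 < h by apply: geometric_exponent_gt0 (gordon_ratio_gt1 _);
  exact: trace_growth_gt1.
set g2 := gu + 2 * g1 + g1 / h.
have gh : 0 < g1 / h by rewrite divr_gt0.
have g2_gt0 : 0 < g2 by rewrite /g2; lra.
(* The exponent of the upper power law is enlarged so that beta is at most 1 and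
   at most 2 h, as the bound on arcs requires. *)
exists g1, g2, (64 `^ (- g1)), (Num.sqrt (Au * lu)), 4; split.
  have lu0 : 0 < lu := lt_trans ltr01 lu_gt1.
  by split; [| |exact: powR_gt0|rewrite sqrtr_gt0 mulr_gt0|].
split.
  move=> z hz eta heta eta1 L L4.
  have [s s1 sz] := circle_sqrt (proj1 hz); rewrite -sz in hz heta.
  apply/andP; split.
    by apply: norm_at_lower => // i;
      apply: (solution_lower ha hb halpha hfib s1 hz heta eta1).
  have L1 : 1 <= L by lra.
  apply: le_trans (norm_at_upper (eta := eta) lu_gt1 (ltW Au_gt0) L1 _) _.
    by move=> i; apply: (solution_upper ha hb halpha hfib s1 hz heta eta1).
  by rewrite ler_wpM2l ?sqrtr_ge0 //; apply: ler_powR => //; rewrite -/gu /g2; lra.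
move=> mu0 mu1 hmu0 hmu1.
set beta := 2 * g1 / (g1 + g2).
have g12 : 0 < g1 + g2 by rewrite addr_gt0.
have b1 : beta <= 1 by rewrite /beta ler_pdivrMr // mul1r /g2; lra.
have b2 : beta <= 2 * h.
  rewrite /beta ler_pdivrMr // -mulrA ler_pM2l // -ler_pdivrMl //.
  by rewrite mulrC /g2; lra.
have [A0 A0p hA0] := spectral_arc_holder ha hb halpha hfib (leq0n 1) hmu0 b1 b2.
have [A1 A1p hA1] := spectral_arc_holder ha hb halpha hfib (leqnn 1) hmu1 b1 b2.
exists (A0 + A1), (10 * szego_size a b ^+ 2)^-1; split.
- by rewrite addr_gt0.
- by rewrite invr_gt0; have := kappa_ge10 ha hb; lra.
move=> Theta e hT he; rewrite [X in (X <= _)%E](measure_addE mu0 mu1) mulrDl EFinD.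
by apply: leeD; [exact: hA0|exact: hA1].
Qed.
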